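(* Fix an integer $m\geq 2$. Then, up to isomorphism, there are only finitely many distance-regular Terwilliger graphs with smallest eigenvalue at least $-m$ and intersection number $c_2\ge 2$.
   Context: A finite connected graph $\Gamma$ with diameter $D$ is distance-regular if there are integers $b_i,c_i$ ($0\le i\le D$) such that for any vertices $x,y$ with $d(x,y)=i$, exactly $c_i$ neighbours of $y$ are at distance $i-1$ from $x$ and exactly $b_i$ neighbours of $y$ are at distance $i+1$ from $x$. The smallest eigenvalue is that of the adjacency matrix. A graph with diameter at least $2$ is a Terwilliger graph if for any two vertices $x,y$ at distance $2$, the set of common neighbours of $x$ and $y$ induces a clique (equivalently, the graph has no induced $4$-cycle). *)

(* Defs.v *)
From mathcomp Require Import all_boot all_order all_algebra algC.
Set Implicit Arguments. Unset Strict Implicit. Unset Printing Implicit Defensive.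
Import Order.TTheory GRing.Theory Num.Theory.

Definition simple_graph (n : nat) (e : rel 'I_n) : Prop :=
  (forall x y, e x y = e y x) /\ (forall x, ~~ e x x).

Fixpoint ball (n : nat) (e : rel 'I_n) (k : nat) (x : 'I_n) : {set 'I_n} :=
  match k with
  | 0 => [set x]
  | k'.+1 => ball e k' x :|: [set y | [exists z in ball e k' x, e z y]]
  end.

Definition dist_is (n : nat) (e : rel 'I_n) (k : nat) (x y : 'I_n) : bool :=
  match k with
  | 0 => y == x
  | k'.+1 => (y \in ball e k x) && (y \notin ball e k' x)
  end.

Definition connected_graph (n : nat) (e : rel 'I_n) : Prop :=
  forall x y : 'I_n, exists k, y \in ball e k x.

(* Distance-regular with intersection numbers b_i, c_i (c_0 is irrelevant:
   the condition on c is imposed for i >= 1). *)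
Definition distance_regular (n : nat) (e : rel 'I_n) (b c : nat -> nat) : Prop :=
  simple_graph e /\ connected_graph e /\
  (forall i x y, dist_is e i.+1 x y ->
     #|[set z | e y z && dist_is e i x z]| = c i.+1) /\
  (forall i x y, dist_is e i x y ->
     #|[set z | e y z && dist_is e i.+1 x z]| = b i).

Definition terwilliger (n : nat) (e : rel 'I_n) : Prop :=
  (exists x y, dist_is e 2 x y) /\
  (forall x y, dist_is e 2 x y ->
     forall u v, e x u -> e y u -> e x v -> e y v -> u != v -> e u v).

Definition adj_mx (n : nat) (e : rel 'I_n) : 'M[algC]_n :=
  \matrix_(i, j) ((e i j)%:R)%R.

Local Open Scope ring_scope.
(* all eigenvalues (equivalently the smallest one; they are real) >= -m *)
Definition smallest_eig_ge (n : nat) (e : rel 'I_n) (m : nat) : Prop :=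
  forall a : algC, eigenvalue (adj_mx e) a -> - (m%:R) <= a.

Definition graph_iso (n k : nat) (e : rel 'I_n) (g : rel 'I_k) : Prop :=
  exists f : 'I_n -> 'I_k, bijective f /\ forall x y, e x y = g (f x) (f y).

(* Main.v *)
(* The hypothesis on the eigenvalues says that A + m is positive semidefinite.
   Hence there is no claw K_{1,m^2+1}, and a vertex outside a clique is adjacent
   either to few or to almost all of its vertices.

   Bounding the valency. If some clique is much larger than c_2, then a largest
   clique B1 meets another large clique B2 in exactly one vertex x (otherwise
   the number a_1 of common neighbours of an edge would be too large); the
   absence of induced quadrangles leaves few edges between B1 and B2, and then
   most pairs in B1 x B2 have no common neighbour except x, contradicting
   c_2 >= 2. So all cliques have O(c_2) vertices, and since a neighbourhood has
   no large coclique, the valency is O(c_2) too. By pigeonhole and Ramsey, if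
   c_2 is large then b_1 is bounded; but the c_2 - 1 common neighbours of two
   non-adjacent vertices of a local graph give c_2 - 1 <= 2 b_1.

   Bounding the diameter. If c_2 >= 2, the pair (c_i, b_i) cannot be constant on
   an interval [s, 4s]: such an interval can always be extended downwards, first
   for b by a double count and then for c, until c_1 = c_2. As c_i increases and
   b_i decreases within [0, k], the diameter is at most exponential in k. *)

Require Import Defs.
From mathcomp Require Import all_boot all_order all_algebra algC.
From mathcomp Require Import spectral sesquilinear.
From mathcomp Require Import zify ring.
Set Implicit Arguments. Unset Strict Implicit. Unset Printing Implicit Defensive.

(** * The quadratic form of the adjacency matrix *)

Section QuadraticForm.
Import Order.TTheory GRing.Theory Num.Theory.
Local Open Scope ring_scope.

Lemma adj_mx_hermitian (n : nat) (e : rel 'I_n) :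
  (forall x y, e x y = e y x) -> adj_mx e \is hermsymmx.
Proof.
move=> esym; apply: realsym_hermsym.
  apply/is_hermitianmxP/matrixP => i j.
  by rewrite expr0 scale1r !mxE esym.
by apply/mxOverP => i j; rewrite mxE realn.
Qed.

(** The rows of the unitary matrix [spectralmx] are left eigenvectors, nonzero because that matrix
    is invertible, so each diagonal entry is an eigenvalue. *)
Lemma spectral_diag_ge (n : nat) (e : rel 'I_n) (m : nat) (i : 'I_n) :
  (forall x y, e x y = e y x) -> smallest_eig_ge e m ->
  - m%:R <= spectral_diag (adj_mx e) 0 i.
Proof.
move=> esym; apply; apply/eigenvalueP.
have Au := spectral_unit (adj_mx e).
have /orthomx_spectralP Aeq := hermitian_normalmx (adj_mx_hermitian esym).
exists (row i (spectralmx (adj_mx e))).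
  rewrite {2}Aeq -row_mul !mulmxA mulmxV // mul1mx.
  by apply/rowP => j; rewrite !mxE (bigD1 i) //= mxE eqxx big1 ?addr0 // =>
    k /negPf ki; rewrite mxE eq_sym ki mulr0n mul0r.
apply/eqP => r0.
have: row i (spectralmx (adj_mx e) *m invmx (spectralmx (adj_mx e))) = 0.
  by rewrite row_mul r0 mul0mx.
rewrite mulmxV // => /rowP /(_ i) /eqP; rewrite !mxE eqxx.
by rewrite oner_eq0.
Qed.

(** In the coordinates [w] of an orthonormal eigenbasis the form is a sum of terms
    [(D 0 i + m) * |w 0 i|^2]. Integer test vectors keep later computations free of algebraic
    numbers. *)
Lemma adj_mx_form_ge0 (n : nat) (e : rel 'I_n) (m : nat) (f : 'I_n -> int) :
  (forall x y, e x y = e y x) -> smallest_eig_ge e m ->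
  0 <= (\sum_x \sum_y f x * (e x y)%:R * f y) + m%:R * \sum_x f x * f x :> int.
Proof.
move=> esym em; rewrite -(ler0z algC).
pose v : 'rV[algC]_n := \row_i (f i)%:~R.
pose P := spectralmx (adj_mx e); pose D := spectral_diag (adj_mx e).
have Pu : P \is unitarymx by apply: spectral_unitarymx.
have /orthomx_spectralP Aeq := hermitian_normalmx (adj_mx_hermitian esym).
have vreal : (v ^t*)%sesqui = v^T.
  by apply/matrixP => i j; rewrite !mxE; apply/CrealP; rewrite realz.
pose w := v *m (P ^t*)%sesqui.
have wE : P *m v^T = (w ^t*)%sesqui.
  by rewrite /w -vreal trmx_mul map_mxM trmxCK.
have -> : (\sum_x \sum_y f x * (e x y)%:R * f y + m%:R * \sum_x f x * f x)%:~R
    = (v *m adj_mx e *m v^T) 0 0 + m%:R * (v *m v^T) 0 0.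
  rewrite rmorphD rmorphM /= rmorph_nat; congr (_ + _ * _).
    rewrite mxE exchange_big rmorph_sum; apply: eq_bigr => y _ /=.
    rewrite !mxE mulr_suml rmorph_sum; apply: eq_bigr => x _ /=.
    by rewrite !mxE !rmorphM /= rmorph_nat.
  by rewrite mxE rmorph_sum; apply: eq_bigr => x _; rewrite !mxE rmorphM.
have -> : v *m v^T = w *m (w ^t*)%sesqui.
  rewrite -wE /w -invmx_unitary // -mulmxA mulKmx //.
  exact: spectral_unit.
have -> : v *m adj_mx e *m v^T = w *m diag_mx D *m (w ^t*)%sesqui.
  by rewrite {1}Aeq -wE /w -invmx_unitary // !mulmxA.
rewrite !mxE mulr_sumr -big_split /=; apply: sumr_ge0 => i _.
rewrite mul_mx_diag !mxE.
rewrite [_ * D 0 i]mulrC -mulrA -mulrDl mulr_ge0 //; last exact: mul_conjC_ge0.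
by rewrite -lerBlDr sub0r spectral_diag_ge.
Qed.

Definition edges_between (T : finType) (e : rel T) (A B : {set T}) : nat :=
  \sum_(x in A) \sum_(y in B) e x y.

Lemma edges_betweenE (T : finType) (e : rel T) (A B : {set T}) :
  \sum_x \sum_y (x \in A)%:R * (e x y)%:R * (y \in B)%:R
    = (edges_between e A B)%:R :> int.
Proof.
rewrite /edges_between natr_sum [RHS]big_mkcond /=; apply: eq_bigr => x _.
case: (x \in A); last by rewrite big1 // => y _; rewrite !mul0r.
rewrite natr_sum [RHS]big_mkcond /=; apply: eq_bigr => y _.
by rewrite mul1r; case: (y \in B); rewrite ?mulr1 ?mulr0.
Qed.

Lemma edges_betweenC (T : finType) (e : rel T) (A B : {set T}) :
  (forall x y, e x y = e y x) -> edges_between e A B = edges_between e B A.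
Proof.
move=> esym; rewrite /edges_between exchange_big.
by apply: eq_bigr => x _; apply: eq_bigr => y _; rewrite esym.
Qed.

(** The test vector takes the values [p], [q], [r] on three disjoint sets and 0 elsewhere. *)
Lemma three_set_form_ge0 (n : nat) (e : rel 'I_n) (m : nat)
    (A B C : {set 'I_n}) (p q r : int)
    (E := fun X Y => (edges_between e X Y)%:R : int) :
  (forall x y, e x y = e y x) -> smallest_eig_ge e m ->
  [disjoint A & B] -> [disjoint A & C] -> [disjoint B & C] ->
  0 <= p ^+ 2 * (E A A + m%:R * #|A|%:R) + q ^+ 2 * (E B B + m%:R * #|B|%:R)
     + r ^+ 2 * (E C C + m%:R * #|C|%:R)
     + 2 * p * q * E A B + 2 * p * r * E A C + 2 * q * r * E B C.
Proof.
move=> esym em dAB dAC dBC.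
pose f x : int := p * (x \in A)%:R + q * (x \in B)%:R + r * (x \in C)%:R.
suff -> : p ^+ 2 * (E A A + m%:R * #|A|%:R) + q ^+ 2 * (E B B + m%:R * #|B|%:R)
     + r ^+ 2 * (E C C + m%:R * #|C|%:R)
     + 2 * p * q * E A B + 2 * p * r * E A C + 2 * q * r * E B C
     = (\sum_x \sum_y f x * (e x y)%:R * f y) + m%:R * \sum_x f x * f x.
  exact: adj_mx_form_ge0.
have -> : \sum_x f x * f x = p ^+ 2 * #|A|%:R + q ^+ 2 * #|B|%:R + r ^+ 2 * #|C|%:R.
  have cardE (X : {set 'I_n}) : #|X|%:R = \sum_x (x \in X)%:R :> int.
    rewrite -sum1_card natr_sum big_mkcond; apply: eq_bigr => x _.
    by case: (_ \in _).
  rewrite !cardE !mulr_sumr -!big_split /=; apply: eq_bigr => x _; rewrite /f.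
  have disj0 (X Y : {set 'I_n}) : [disjoint X & Y] ->
      (x \in X)%:R * (x \in Y)%:R = 0 :> int.
    by move=> dXY; case: (boolP (x \in X)) => [/(disjointFr dXY)->|_]; rewrite ?mulr0 ?mul0r.
  have idem (X : {set 'I_n}) : (x \in X)%:R * (x \in X)%:R = (x \in X)%:R :> int.
    by case: (x \in X); rewrite ?mulr1 ?mulr0.
  move: (disj0 _ _ dAB) (disj0 _ _ dAC) (disj0 _ _ dBC) (idem A) (idem B) (idem C).
  move: (_ \in A)%:R (_ \in B)%:R (_ \in C)%:R => u v w uv uw vw uu vv ww.
  have -> : (p * u + q * v + r * w) * (p * u + q * v + r * w) =
    p ^+ 2 * (u * u) + q ^+ 2 * (v * v) + r ^+ 2 * (w * w) +
    2 * p * q * (u * v) + 2 * p * r * (u * w) + 2 * q * r * (v * w) by ring.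
  by rewrite uv uw vw uu vv ww !mulr0 !addr0.
have -> : \sum_x \sum_y f x * (e x y)%:R * f y =
    p ^+ 2 * E A A + q ^+ 2 * E B B + r ^+ 2 * E C C
  + p * q * (E A B + E B A) + p * r * (E A C + E C A) + q * r * (E B C + E C B).
  rewrite /E -!edges_betweenE !mulrDr !mulr_sumr -!big_split /=.
  apply: eq_bigr => x _; rewrite !mulr_sumr -!big_split /=.
  by apply: eq_bigr => y _; rewrite /f; ring.
rewrite /E (edges_betweenC B A) // (edges_betweenC C A) // (edges_betweenC C B) //.
ring.
Qed.

(** * Cliques, cocliques and their eigenvalue bounds *)

Definition clique (T : finType) (e : rel T) (K : {set T}) : bool :=
  [forall x in K, forall y in K, (x != y) ==> e x y].

Definition indep (T : finType) (e : rel T) (K : {set T}) : bool :=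
  [forall x in K, forall y in K, ~~ e x y].

Lemma cliqueP (T : finType) (e : rel T) (K : {set T}) :
  reflect {in K &, forall x y, x != y -> e x y} (clique e K).
Proof.
apply: (iffP forall_inP) => [H x y xK yK xy|H x xK].
  by have /forall_inP /(_ _ yK) /implyP := H _ xK; apply.
by apply/forall_inP => y yK; apply/implyP; apply: H.
Qed.

Lemma indepP (T : finType) (e : rel T) (K : {set T}) :
  reflect {in K &, forall x y, ~~ e x y} (indep e K).
Proof.
apply: (iffP forall_inP) => [H x y xK yK|H x xK].
  by have /forall_inP := H _ xK; apply.
by apply/forall_inP => y yK; apply: H.
Qed.

Lemma edges_between_full (T : finType) (e : rel T) (A B : {set T}) :
  {in A & B, forall x y, e x y} -> edges_between e A B = (#|A| * #|B|)%N.
Proof.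
move=> H; rewrite /edges_between -sum_nat_const; apply: eq_bigr => x xA.
by rewrite -sum1_card; apply: eq_bigr => y yB; rewrite H.
Qed.

Lemma edges_between_none (T : finType) (e : rel T) (A B : {set T}) :
  {in A & B, forall x y, ~~ e x y} -> edges_between e A B = 0%N.
Proof.
move=> H; rewrite /edges_between big1 // => x xA; rewrite big1 // => y yB.
by rewrite (negPf (H _ _ xA yB)).
Qed.

Lemma edges_between_clique (T : finType) (e : rel T) (A : {set T}) :
  (forall x, ~~ e x x) -> clique e A -> edges_between e A A = (#|A| * #|A|.-1)%N.
Proof.
move=> eirr /cliqueP H; rewrite /edges_between -sum_nat_const.
apply: eq_bigr => x xA.
rewrite (bigD1 x) //= (negPf (eirr x)) add0n.
rewrite (cardsD1 x) xA /= -sum1_card.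
rewrite [LHS](eq_bigl (fun y => y \in A :\ x)).
  by apply: eq_bigr => y; rewrite !inE eq_sym => /andP[xy yA]; rewrite H.
by move=> y; rewrite !inE andbC.
Qed.

(** The weights [-m] at the centre [x] and 1 on [I] give [m * (m^2 - #|I|) >= 0]. *)
Lemma claw_bound (n : nat) (e : rel 'I_n) (m : nat) (x : 'I_n) (I : {set 'I_n}) :
  simple_graph e -> smallest_eig_ge e m -> (0 < m)%N ->
  indep e I -> {in I, forall y, e x y} -> (#|I| <= m ^ 2)%N.
Proof.
move=> [esym eirr] em m_gt0 /indepP indI xI.
have xnI : [disjoint [set x] & I].
  by rewrite disjoints1; apply/negP => /xI; apply/negP.
have disj0 (A : {set 'I_n}) : [disjoint A & set0] by rewrite -setI_eq0 setI0.
have := three_set_form_ge0 (- m%:R) 1 0 esym em xnI (disj0 _) (disj0 _).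
rewrite (edges_between_none (A := [set x]) (B := [set x])); last first.
  by move=> y z /set1P-> /set1P->.
rewrite (edges_between_none indI) (edges_between_full (A := [set x]) (B := I)); last first.
  by move=> y z /set1P-> /xI.
rewrite cards1 cards0 mul1n expr0n /= !mulr0 !mul0r !addr0 expr1n !mul1r mulr1 !add0r.
have -> : (- m%:R) ^+ 2 * (m%:R * 1) + m%:R * #|I|%:R + 2 * (- m%:R) * #|I|%:R =
  m%:R * ((m ^ 2)%:R - #|I|%:R) :> int by rewrite natrX; ring.
by rewrite pmulr_rge0 ?ltr0n // subr_ge0 ler_nat.
Qed.

(** The weights [m * #|S|] on [Z] and [-m * #|Z|] on [S] sum to zero over the clique, which thus
    contributes only [m - 1] times the sum of their squares. The weight [#|Z| * #|S|] at [y]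
    minimises the resulting quadratic. *)
Lemma partial_clique_bound (n : nat) (e : rel 'I_n) (m : nat) (y : 'I_n)
    (Z S : {set 'I_n}) :
  simple_graph e -> smallest_eig_ge e m -> (0 < m)%N ->
  [disjoint Z & S] -> clique e (Z :|: S) -> y \notin Z ->
  {in S, forall z, e y z} -> {in Z, forall z, ~~ e y z} ->
  (#|Z| * #|S| <= m * m.-1 * (#|Z| + #|S|))%N.
Proof.
move=> [esym eirr] em m_gt0 dZS cl ynZ yS yZ.
have dyZ : [disjoint [set y] & Z] by rewrite disjoints1.
have dyS : [disjoint [set y] & S].
  by rewrite disjoints1; apply/negP => /yS; apply/negP.
have := three_set_form_ge0 (#|Z| * #|S|)%:R (m * #|S|)%:R (- (m * #|Z|)%:R)
  esym em dyZ dyS dZS.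
have clZ : clique e Z.
  by apply/cliqueP => a b aZ bZ; apply: (cliqueP _ _ cl); rewrite inE ?aZ ?bZ.
have clS : clique e S.
  by apply/cliqueP => a b aS bS; apply: (cliqueP _ _ cl); rewrite inE ?aS ?bS orbT.
rewrite (edges_between_none (A := [set y]) (B := [set y])); last first.
  by move=> a b /set1P-> /set1P->.
rewrite (edges_between_none (A := [set y]) (B := Z)); last by move=> a b /set1P-> /yZ.
rewrite (edges_between_full (A := [set y]) (B := S)); last by move=> a b /set1P-> /yS.
rewrite (edges_between_full (A := Z) (B := S)); last first.
  move=> a b aZ bS; apply: (cliqueP _ _ cl); rewrite ?inE ?aZ ?bS ?orbT //.
  by apply: contraTneq aZ => ->; rewrite (disjointFl dZS).
rewrite !edges_between_clique // cards1.
case Zp : #|Z| => [|p]; first by nia.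
case Sq : #|S| => [|q]; first by nia.
case: m m_gt0 {em} => // m _.
rewrite /= !natrM => H.
suff : 0 <= (m.+1%:R * p.+1%:R * q.+1%:R) *
  (m.+1%:R * m%:R * (p.+1%:R + q.+1%:R) - p.+1%:R * q.+1%:R) :> int.
  by rewrite pmulr_rge0 ?mulr_gt0 // subr_ge0 -natrD -!natrM ler_nat.
apply: le_trans H _; rewrite le_eqVlt; apply/orP; left; apply/eqP.
rewrite -!natr1; ring.
Qed.

End QuadraticForm.

(** * Runs of constant intersection numbers *)

Lemma card_set_sum (T : finType) (A : {set T}) (P : pred T) :
  #|[set x in A | P x]| = \sum_(x in A) P x.
Proof.
rewrite -sum1_card big_mkcond [RHS]big_mkcond /=; apply: eq_bigr => x _.
by rewrite inE; case: (x \in A) => //=; case: (P x).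
Qed.

Lemma double_count (T1 T2 : finType) (A : {set T1}) (B : {set T2}) (R : T1 -> T2 -> bool) :
  \sum_(x in A) #|[set y in B | R x y]| = \sum_(y in B) #|[set x in A | R x y]|.
Proof.
under eq_bigr => x _ do rewrite card_set_sum.
by rewrite exchange_big; apply: eq_bigr => y _; rewrite card_set_sum.
Qed.

Lemma sum_mem_subset (T : finType) (A B : {set T}) :
  A \subset B -> \sum_(x in B) (x \in A) = #|A|.
Proof.
move=> /subsetP sAB; rewrite -card_set_sum; apply: eq_card => x.
by rewrite inE; case: (boolP (x \in A)) => [/sAB->|]; rewrite ?andbF.
Qed.

Lemma card_setD_swap (T : finType) (A B : {set T}) :
  #|A| = #|B| -> #|A :\: B| = #|B :\: A|.
Proof. by rewrite !cardsD setIC => ->. Qed.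

Section ConstantRun.

Variables (T : finType) (d : T -> T -> nat) (b c : nat -> nat).

(** The strict inequality needs no predecessor of [d x y], so [x = y] is no special case:
    [closer x x] is empty. *)
Definition closer x y := [set z | (d y z == 1) && (d x z < d x y)].
Definition farther x y := [set z | (d y z == 1) && (d x y < d x z)].

Hypothesis d_sym : forall x y, d x y = d y x.
Hypothesis d_xx : forall x, d x x = 0.
Hypothesis d_eq0 : forall x y, d x y = 0 -> x = y.
Hypothesis d_tri : forall x y z, d x z <= d x y + d y z.
Hypothesis d_step : forall x y k, d x y = k.+1 -> exists2 z, d x z = k & d z y = 1.
Hypothesis card_closer : forall x y, 0 < d x y -> #|closer x y| = c (d x y).
Hypothesis card_farther : forall x y, #|farther x y| = b (d x y).

Lemma closerP x y z : reflect (d y z = 1 /\ d x z < d x y) (z \in closer x y).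
Proof. by rewrite inE; apply: (iffP andP) => -[/eqP]. Qed.

Lemma fartherP x y z : reflect (d y z = 1 /\ d x y < d x z) (z \in farther x y).
Proof. by rewrite inE; apply: (iffP andP) => -[/eqP]. Qed.

Lemma closer_sub x u z : d x u + d u z = d x z -> closer u z \subset closer x z.
Proof.
move=> geo; apply/subsetP => w /closerP[zw uw]; apply/closerP; split => //.
by have := d_tri x u w; lia.
Qed.

Lemma farther_sub x u z : d x u + d u z = d x z -> farther x z \subset farther u z.
Proof.
move=> geo; apply/subsetP => w /fartherP[zw xw]; apply/fartherP; split => //.
by have := d_tri x u w; lia.
Qed.

(** Inclusion along a geodesic plus equal cardinality. With its companion for [farther], this turns
    constancy of the intersection numbers into structure. *)
Lemma closer_eq x u z : d x u + d u z = d x z -> 0 < d u z ->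
  c (d u z) = c (d x z) -> closer u z = closer x z.
Proof.
move=> geo uz cE; apply/eqP; rewrite eqEcard closer_sub //=.
by rewrite !card_closer ?cE //; lia.
Qed.

Lemma farther_eq x u z : d x u + d u z = d x z ->
  b (d u z) = b (d x z) -> farther x z = farther u z.
Proof.
move=> geo bE; apply/eqP; rewrite eqEcard farther_sub //=.
by rewrite !card_farther bE.
Qed.

Lemma between i j x z : d x z = i + j -> exists2 u, d x u = i & d u z = j.
Proof.
elim: j z => [|j IHj] z xz; first by exists z; rewrite ?d_xx //; lia.
rewrite addnS in xz; have [w xw wz] := d_step xz.
have [u xu uw] := IHj _ xw; exists u => //.
by have := d_tri x u z; have := d_tri u w z; lia.
Qed.

Lemma closer_ex x z : 0 < d x z -> exists2 w, d z w = 1 & d x w = (d x z).-1.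
Proof.
move=> xz; have /d_step[w xw wz] : d x z = (d x z).-1.+1 by lia.
by exists w => //; rewrite d_sym.
Qed.

Section Realized.

Variable M : nat.
Hypothesis M_realized : exists x y, d x y = M.

Lemma realized i : i <= M -> exists x y, d x y = i.
Proof.
move=> iM; have [x [y xy]] := M_realized.
have [|u xu uy] := @between i (M - i) x y; first by lia.
by exists x, u.
Qed.

Lemma b_gt0 i : i < M -> 0 < b i.
Proof.
move=> iM; have [x [y xy]] := realized iM.
have [z xz zy] := d_step xy.
by rewrite -xz -card_farther; apply/card_gt0P; exists y; apply/fartherP; split=> //; lia.
Qed.

Lemma c_gt0 i : 0 < i <= M -> 0 < c i.
Proof.
case/andP=> i0 iM; have [x [y xy]] := realized iM.
have [|z yz xz] := @closer_ex x y; first by lia.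
rewrite -xy -card_closer; last by lia.
by apply/card_gt0P; exists z; apply/closerP; split=> //; lia.
Qed.

Lemma c_mono i : 0 < i < M -> c i <= c i.+1.
Proof.
case/andP=> i0 iM; have [x [y xy]] := realized iM.
have [|u xu uy] := @between 1 i x y; first by lia.
have /closer_sub/subset_leq_card : d x u + d u y = d x y by lia.
by rewrite !card_closer ?uy ?xy //; lia.
Qed.

Lemma b_mono i : i < M -> b i.+1 <= b i.
Proof.
move=> iM; have [x [y xy]] := realized iM.
have [|u xu uy] := @between 1 i x y; first by lia.
have /farther_sub/subset_leq_card : d x u + d u y = d x y by lia.
by rewrite !card_farther ?uy ?xy //; lia.
Qed.

Lemma extend j x z : d x z <= j <= M -> exists2 y, d x y = j & d z y = j - d x z.
Proof.
move=> /andP[xzj]; have [t ->] : exists t, j = d x z + t by exists (j - d x z); lia.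
move=> {xzj j}; elim: t => [|t IHt] tM.
  by exists z; rewrite ?d_xx; lia.
have [|y xy zy] := IHt; first by lia.
have /card_gt0P[w /fartherP[yw xw]] : 0 < #|farther x y|.
  by rewrite card_farther b_gt0 //; lia.
by exists w; have := d_tri x y w; have := d_tri x z w; have := d_tri z y w; lia.
Qed.

End Realized.

(** * One step down from a run of constant intersection numbers *)

Section Run.

Variables s M : nat.
Hypothesis s_gt1 : 1 < s.
Hypothesis s_le_M : 4 * s <= M.
Hypothesis M_realized : exists x y, d x y = M.
Hypothesis c_run : forall i, s <= i <= M -> c i = c s.
Hypothesis b_run : forall i, s <= i <= M -> b i = b s.

(** Both [d x y] and [d v y] lie in the run, so [x] and [v] have the same closer and the same
    farther neighbours of [y]: moving from [y] to [z] changes both distances alike. *)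
Lemma pipe_closed x v y z : d x v = 1 -> s < d x y <= M -> (d v y).+1 = d x y ->
  d y z = 1 -> (d v z).+1 = d x z.
Proof.
move=> xv xyM vy yz.
have Ec : closer v y = closer x y.
  apply: closer_eq; [lia|lia|].
  by rewrite !c_run //; lia.
have Eb : farther x y = farther v y.
  apply: farther_eq; first lia.
  by rewrite !b_run //; lia.
have := d_tri x y z; have := d_tri v y z.
have := d_tri x z y; have := d_tri v z y; have := d_sym y z.
case: (ltngtP (d x z) (d x y)) => xz.
- have : z \in closer v y by rewrite Ec; apply/closerP.
  by move=> /closerP[]; lia.
- have : z \in farther v y by rewrite -Eb; apply/fartherP.
  by move=> /fartherP[]; lia.
- have : z \notin closer v y by rewrite Ec; apply/negP => /closerP[]; lia.
  have : z \notin farther v y by rewrite -Eb; apply/negP => /fartherP[]; lia.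
  move=> /fartherP H1 /closerP H2.
  have : ~ (d v z < d v y) by move=> ?; apply: H2.
  have : ~ (d v y < d v z) by move=> ?; apply: H1.
  lia.
Qed.

(** If [w] were at distance [s] from [v], all of [closer x0 v] would lie in [closer w v], and equal
    sizes would make the sets coincide; but a neighbour [t] of [v] on the way to [z] lies only in
    the second. *)
Lemma dist_closer_le x0 v z w : s <= d x0 v -> d v z = s.-1 ->
  d x0 z = d x0 v + s.-1 -> d x0 z <= M -> w \in closer x0 z -> d v w <= s.-1.
Proof.
move=> sv vz x0z zM wz; have /closerP[zw x0w] := wz.
rewrite leqNgt; apply/negP => vw_gt.
have vw : d v w = s by have := d_tri v z w; lia.
have sub : closer x0 v \subset closer w v.
  apply/subsetP => u /closerP[vu x0u]; apply/closerP; split => //.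
  have uz : d u z = s.
    by have := d_tri x0 u z; have := d_tri u v z; have := d_sym u v; lia.
  have x0uE : d x0 u = (d x0 v).-1.
    by have := d_tri x0 u v; have := d_sym u v; lia.
  have : w \in closer u z.
    rewrite (closer_eq (x := x0)) //; try lia.
    by rewrite uz (c_run (i := d x0 z)) //; lia.
  by move=> /closerP[]; rewrite (d_sym w u) (d_sym w v); lia.
have E : closer x0 v = closer w v.
  apply/eqP; rewrite eqEcard sub /= !card_closer; try lia.
    by rewrite (d_sym w v) vw (c_run (i := d x0 v)) //; lia.
  by rewrite d_sym; lia.
have [|t vt zt] := @closer_ex z v; first by rewrite d_sym; lia.
have : t \in closer x0 v.
  rewrite E; apply/closerP; split => //.
  by have := d_tri w z t; rewrite (d_sym w v) (d_sym w z) (d_sym z v) in zt *; lia.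
move=> /closerP[_]; rewrite d_sym in vz.
by have := d_tri x0 t z; rewrite (d_sym t z); lia.
Qed.

(** Iterates [pipe_closed] along a path from [y]. As [y] has depth [2 * s - 1], a vertex fewer than
    [s - 1] steps away from it is still at distance more than [s] from [x]. *)
Lemma near_deep_vertex x v y g : d x v = 1 -> d x y = (2 * s).-1 ->
  (d v y).+1 = d x y -> d y g <= s.-1 -> (d v g).+1 = d x g.
Proof.
move=> xv xy vy; move t : (d y g) => r.
elim: r g t => [|r IHr] g yg rs; first by rewrite -(d_eq0 yg).
have [g' yg' g'g] := d_step yg.
apply: (@pipe_closed x v g' g) => //; last by apply: IHr => //; lia.
have := d_tri x g' y; have := d_tri x y g'; rewrite (d_sym g' y); lia.
Qed.

(** A geodesic from [x] to [z] is prolonged to [y] at distance [2 * s - 1] from [x]. Near [y] the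
    distances from [x] and [v] differ by one, which puts [closer y w] at level [s] and inside
    [closer v w]; both sets have [c s] elements. *)
Lemma closer_same_level x v z w g : d x v = 1 -> d x z = s -> d v z = s.-1 ->
  d x w = s -> d z w = 1 -> d v w = s -> g \in closer v w -> d x g = s.
Proof.
move=> xv xz vz xw zw vw.
have [|y xy zy] := @extend M M_realized (2 * s).-1 x z; first by lia.
have vy : (d v y).+1 = d x y.
  by have := d_tri v z y; have := d_tri x v y; lia.
have near := near_deep_vertex xv xy vy.
have yw : d y w = s.
  have le1 : d y w <= s by have := d_tri y z w; rewrite (d_sym y z); lia.
  case: (leqP (d y w) s.-1) => [/near|]; lia.
have gE h : h \in closer y w -> d x h = s /\ h \in closer v w.
  move=> /closerP[wh yh].
  have vh : (d v h).+1 = d x h by apply: near; lia.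
  have hs : s <= d x h by have := d_tri x h y; rewrite (d_sym h y); lia.
  have hs1 : d x h <= s.+1 by have := d_tri x w h; lia.
  have {hs1} : d x h = s \/ d x h = s.+1 by lia.
  case=> xh; first by split=> //; apply/closerP; split=> //; lia.
  have : (d v w).+1 = d x w by apply: (@pipe_closed x v h w) => //; rewrite 1?(d_sym h w); lia.
  lia.
have E : closer y w = closer v w.
  apply/eqP; rewrite eqEcard; apply/andP; split.
    by apply/subsetP => h /gE[].
  by rewrite !card_closer ?yw ?vw //; lia.
by rewrite -E => /gE[].
Qed.

Section Excess.

Variables x0 x : T.
Hypothesis x0x : d x0 x = s.

(* [Z] and [W] are the vertices at distance [s] and [s-1] from [x] on the side
   of [x] away from [x0]; the triples [(w, u, v)] with [w] in [Z], [u] in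
   [closer x w] and [v] in [good w] are counted in two ways. *)
Let V := farther x0 x.
Let Z := [set w | (d x w == s) && (d x0 w == 2 * s)].
Let W := [set w | (d x w == s.-1) && (d x0 w == (2 * s).-1)].
Let good w := [set v in V | (d v w == s) && [forall u in closer x w, d v u == s]].

Lemma in_Z w : (w \in Z) = (d x w == s) && (d x0 w == 2 * s).
Proof. by rewrite inE. Qed.

Lemma closer_Z w : w \in Z -> closer x w = closer x0 w.
Proof.
rewrite inE => /andP[/eqP xw /eqP x0w]; apply: closer_eq; try lia.
by rewrite x0w (c_run (i := 2 * s)) ?xw //; lia.
Qed.

Lemma farther_Z w : w \in Z -> farther x w = farther x0 w.
Proof.
rewrite inE => /andP[/eqP xw /eqP x0w]; apply/esym/farther_eq; try lia.
by rewrite x0w (b_run (i := 2 * s)) ?xw //; lia.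
Qed.

Lemma closer_Z_sub w : w \in Z -> closer x w \subset W.
Proof.
move=> wZ; apply/subsetP => u uxw; have := uxw; rewrite (closer_Z wZ).
move=> /closerP[_ x0u]; move: uxw wZ => /closerP[wu xu]; rewrite in_Z => /andP[/eqP xw /eqP x0w].
rewrite inE.
have := d_tri x u w; have := d_tri x0 u w; rewrite (d_sym u w); lia.
Qed.

Lemma farther_W_sub u : u \in W -> farther x0 u \subset Z.
Proof.
rewrite inE => /andP[/eqP xu /eqP x0u]; apply/subsetP => w /fartherP[uw x0w].
rewrite inE; have := d_tri x u w; have := d_tri x0 u w; have := d_tri x0 x w; lia.
Qed.

Lemma closer_x_sub w : w \in Z -> closer w x \subset V.
Proof.
rewrite inE => /andP[/eqP xw /eqP x0w]; apply/subsetP => v /closerP[xv wv].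
apply/fartherP; split=> //; have := d_tri x0 v w; rewrite (d_sym v w).
rewrite (d_sym w x) in wv; lia.
Qed.

(** Counts the edges between [Z] and [W]: each [w] contributes all of [closer x w], each [u] all of
    [farther x0 u]. *)
Lemma card_Z_W : #|Z| * c s = #|W| * b s.
Proof.
have -> : #|Z| * c s = \sum_(w in Z) #|[set u in W | u \in closer x w]|.
  rewrite -sum_nat_const; apply: eq_bigr => w wZ.
  rewrite card_set_sum sum_mem_subset ?closer_Z_sub //.
  move: wZ; rewrite inE => /andP[/eqP xw _].
  by rewrite card_closer ?xw //; lia.
rewrite double_count -sum_nat_const; apply: eq_bigr => u uW.
have -> : [set w in Z | u \in closer x w] = farther x0 u.
  apply/setP => w; rewrite inE; apply/andP/idP => [[wZ]|wu].
    have := uW; rewrite inE => /andP[/eqP xu /eqP x0u].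
    move: wZ; rewrite inE => /andP[/eqP xw /eqP x0w] /closerP[wu _].
    by apply/fartherP; rewrite d_sym wu x0w x0u; split => //; lia.
  have wZ := subsetP (farther_W_sub uW) _ wu; split => //.
  rewrite closer_Z //; move: wu => /fartherP[uw x0uw].
  by apply/closerP; rewrite d_sym.
move: uW; rewrite inE => /andP[_ /eqP x0u].
by rewrite card_farther (b_run (i := d x0 u)) //; lia.
Qed.

(** The witnesses are the vertices of [farther v w] outside [farther x w]: [dist_closer_le] prevents
    them from approaching [x], so they remain in [Z], at distance [s] from [v]. *)
Lemma card_flat w v : w \in Z -> v \in closer w x ->
  b s.-1 - b s <= #|[set y in [set y in Z | d w y == 1] | v \notin closer y x]|.
Proof.
move=> wZ vwx; have := wZ; rewrite inE => /andP[/eqP xw /eqP x0w].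
have /closerP[xv wv] := vwx.
have vw : d v w = s.-1.
  by have := d_tri x v w; rewrite (d_sym v w); rewrite (d_sym w x) in wv; lia.
have /fartherP[_ x0v] := subsetP (closer_x_sub wZ) _ vwx.
have sub : farther x w \subset farther v w by apply: farther_sub; lia.
have -> : b s.-1 - b s = #|farther v w :\: farther x w|.
  by rewrite cardsD (setIidPr sub) !card_farther vw xw.
apply/subset_leq_card/subsetP => y /setDP[/fartherP[wy vy] /fartherP nxy].
have vyE : d v y = s by have := d_tri v w y; lia.
have xy_le : d x y <= s by rewrite leqNgt; apply/negP => ?; apply: nxy; split=> //; lia.
have xy : d x y = s.
  apply/eqP; rewrite eqn_leq xy_le leqNgt /=; apply/negP => xy_lt.
  have : y \in closer x0 w by rewrite -closer_Z //; apply/closerP; split=> //; lia.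
  move=> /(@dist_closer_le x0 v w y); rewrite vw x0w; have := d_tri x0 v w.
  have := d_tri x0 x v; lia.
have x0y : d x0 y = 2 * s.
  have : y \notin farther x0 w by rewrite -farther_Z //; apply/fartherP.
  have : y \notin closer x0 w by rewrite -closer_Z //; apply/negP => /closerP[]; lia.
  move=> /closerP H1 /fartherP H2.
  have : ~ (d x0 y < d x0 w) by move=> ?; apply: H1.
  have : ~ (d x0 w < d x0 y) by move=> ?; apply: H2.
  lia.
rewrite !inE xy x0y wy !eqxx /=; apply/negP => /andP[_].
by rewrite (d_sym y v) (d_sym y x); lia.
Qed.

(** By [closer_same_level] the sets [closer v w] and [closer x w] are disjoint, which yields the
    universal condition in [good]. *)
Lemma excess_good w y v : w \in Z -> y \in Z -> d w y = 1 ->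
  v \in closer y x -> v \notin closer w x -> v \in good w /\ y \in closer v w.
Proof.
move=> wZ yZ wy vyx vnwx; have vV := subsetP (closer_x_sub yZ) _ vyx.
move: wZ yZ; rewrite !in_Z => /andP[/eqP xw /eqP x0w] /andP[/eqP xy /eqP x0y].
have /closerP[xv vy] := vyx.
have vyE : d v y = s.-1.
  by have := d_tri x v y; rewrite (d_sym v y); rewrite (d_sym y x) in vy; lia.
have vw : d v w = s.
  have : ~ (d w v < d w x) by move=> lt; move/negP: vnwx; apply; exact/closerP.
  have := d_tri v y w; rewrite (d_sym y w) (d_sym w v) (d_sym w x); lia.
have yvw : y \in closer v w by apply/closerP; split=> //; lia.
split => //; rewrite inE vV vw eqxx /=.
apply/forall_inP => u /closerP[wu xu].
have : u \notin closer v w.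
  apply/negP => /(@closer_same_level x v y w u xv xy vyE xw); rewrite d_sym => /(_ wy vw).
  lia.
move=> /closerP H; have : ~ (d v u < d v w) by move=> ?; apply: H.
have := d_tri v x u; rewrite (d_sym v x); lia.
Qed.

(** Double count over the neighbours [y] of [w] in [Z]. The sets [closer w x] and [closer y x] have
    equal size, so the losses bounded below by [card_flat] equal the gains; each gained [v] is good
    and is gained for at most [c s] vertices [y]. *)
Lemma card_good w : w \in Z -> b s.-1 - b s <= #|good w|.
Proof.
move=> wZ; have := wZ; rewrite inE => /andP[/eqP xw /eqP x0w].
pose F := [set y in Z | d w y == 1].
have cs : 0 < c s by apply: (c_gt0 M_realized); lia.
have cE y : y \in Z -> #|closer y x| = c s.
  by rewrite inE => /andP[/eqP xy _]; rewrite card_closer d_sym xy //; lia.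
rewrite -(leq_pmul2r cs).
have H1 : (b s.-1 - b s) * c s <= \sum_(y in F) #|closer w x :\: closer y x|.
  have -> : \sum_(y in F) #|closer w x :\: closer y x| =
            \sum_(y in F) #|[set v in closer w x | v \notin closer y x]|.
    by apply: eq_bigr => y _; apply: eq_card => v; rewrite !inE andbC.
  rewrite double_count -(cE _ wZ) mulnC -sum_nat_const.
  by apply: leq_sum => v vwx; apply: card_flat.
apply: leq_trans H1 _.
have -> : \sum_(y in F) #|closer w x :\: closer y x| =
          \sum_(y in F) #|[set v in good w | v \in closer y x :\: closer w x]|.
  apply: eq_bigr => y; rewrite inE => /andP[yZ /eqP wy].
  rewrite card_setD_swap ?cE //; apply: eq_card => v; rewrite inE.
  case: (boolP (v \in _ :\: _)); rewrite ?andbF ?andbT // => /setDP[vyx vnwx].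
  by have [-> _] := excess_good wZ yZ wy vyx vnwx.
rewrite double_count -sum_nat_const; apply: leq_sum => v vg.
have vw : d v w = s by move: vg; rewrite inE => /and3P[_ /eqP].
have <- : #|closer v w| = c s by rewrite card_closer vw //; lia.
apply/subset_leq_card/subsetP => y; rewrite inE => /andP[].
rewrite inE => /andP[yZ /eqP wy] /setDP[vyx vnwx].
by have [] := excess_good wZ yZ wy vyx vnwx.
Qed.

Lemma card_Z_fiber u v : u \in W -> d v u = s -> v \in V ->
  \sum_(w in Z) ((u \in closer x w) && (v \in good w)) <= b s.-1 - b s.
Proof.
rewrite inE => /andP[/eqP xu /eqP x0u] vu /fartherP[xv _].
have sub : farther v u \subset farther x u.
  by apply: farther_sub; rewrite d_sym; lia.
have -> : b s.-1 - b s = #|farther x u :\: farther v u|.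
  by rewrite cardsD (setIidPr sub) !card_farther vu xu.
rewrite -card_set_sum; apply/subset_leq_card/subsetP => w; rewrite inE => /and3P[wZ].
move=> /closerP[wu xw]; rewrite inE => /and3P[_ /eqP vw _].
apply/setDP; split; last by apply/negP => /fartherP[]; lia.
by apply/fartherP; rewrite d_sym.
Qed.

Lemma card_V_far u : u \in W -> #|[set v in V | d v u == s]| < b s.
Proof.
rewrite inE => /andP[/eqP xu /eqP x0u].
have [|v xv uv] := @closer_ex u x; first by rewrite d_sym; lia.
have <- : #|V| = b s by rewrite card_farther x0x.
apply/proper_card/properP; split; first by apply/subsetP => y; rewrite inE => /andP[].
exists v; last by rewrite inE d_sym uv (d_sym u x) xu; lia.
apply/fartherP; split=> //; have := d_tri x0 v u.
by rewrite (d_sym v u) uv (d_sym u x) xu; lia.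
Qed.

(* For fixed [u] there are at most [b s - 1] choices of [v], since a neighbour
   of [x] on the way to [u] lies in [V] but is too close to [u]. *)
Lemma b_no_drop_at : 0 < #|W| -> b s.-1 - b s = 0.
Proof.
move=> W_gt0; set beta := b s.-1 - b s.
have H1 : #|Z| * (c s * beta) <=
    \sum_(w in Z) \sum_(u in W) \sum_(v in V) ((u \in closer x w) && (v \in good w)).
  rewrite -sum_nat_const; apply: leq_sum => w wZ.
  under eq_bigr => u _ do under eq_bigr => v _ do rewrite -mulnb.
  rewrite -big_distrlr /= !sum_mem_subset ?closer_Z_sub //; last first.
    by apply/subsetP => v; rewrite inE => /andP[].
  rewrite leq_mul ?card_good //.
  by move: wZ; rewrite inE => /andP[/eqP xw _]; rewrite card_closer xw //; lia.
have H2 : \sum_(w in Z) \sum_(u in W) \sum_(v in V) ((u \in closer x w) && (v \in good w))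
    <= #|W| * ((b s).-1 * beta).
  rewrite exchange_big -sum_nat_const; apply: leq_sum => u uW /=.
  rewrite exchange_big /=.
  apply: (@leq_trans (\sum_(v in V) (d v u == s) * beta)).
    apply: leq_sum => v vV; case: eqP => vu; first by rewrite mul1n card_Z_fiber.
    rewrite big1 // => w wZ; case: (boolP (u \in _)) => //= uxw.
    case: (boolP (v \in _)) => //; rewrite inE => /and3P[_ _ /forall_inP /(_ _ uxw) /eqP].
    by move/vu.
  rewrite -big_distrl -card_set_sum leq_mul2r.
  by have := card_V_far uW; set k := #|_|; lia.
(* With [beta] positive, the two bounds would give [#|Z| * c s <= #|W| * (b s - 1)], against
   [card_Z_W], since [W] is nonempty. *)
have bs : 0 < b s by apply: (b_gt0 M_realized); lia.
have := card_Z_W; nia.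
Qed.

End Excess.

Lemma b_pred : b s.-1 = b s.
Proof.
have b_le : b s <= b s.-1.
  have := @b_mono M M_realized s.-1; rewrite prednK; last by lia.
  by apply; lia.
have [|x0 [t x0t]] := @realized M M_realized (2 * s); first by lia.
have [|x x0x xt] := @between s s x0 t; first by lia.
have [u xu ut] : exists2 u, d x u = s.-1 & d u t = 1 by apply: d_step; lia.
suff : b s.-1 - b s = 0 by lia.
apply: (b_no_drop_at x0x); apply/card_gt0P; exists u.
have := d_tri x0 u t; have := d_tri x0 x u; rewrite inE; lia.
Qed.

(** If [c] dropped, some [w] closer to [x0] than [z] would be as far from [v] as [z]. Equality of
    the [b]-values, which uses [b_pred], then gives [r] with [closer x0 v = closer r v], and a
    neighbour of [v] towards [w] contradicts this. *)
Lemma c_pred : c s.-1 = c s.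
Proof.
have c_le : c s.-1 <= c s.
  have := @c_mono M M_realized s.-1; rewrite prednK; last by lia.
  by apply; lia.
apply/eqP; rewrite eqn_leq c_le leqNgt /=; apply/negP => c_lt.
have [|x0 [z x0z]] := @realized M M_realized (2 * s).-1; first by lia.
have [|v x0v vz] := @between s s.-1 x0 z; first by lia.
have /subsetPn[w wx0 wv] : ~~ (closer x0 z \subset closer v z).
  apply/negP => /subset_leq_card; rewrite !card_closer ?vz ?x0z; try lia.
  by rewrite (c_run (i := (2 * s).-1)) //; lia.
have /closerP[zw x0w_lt] := wx0.
have vw : d v w = s.-1.
  have := @dist_closer_le x0 v z w; rewrite x0v vz x0z wx0.
  have : ~ (d v w < d v z) by move=> lt; move/negP: wv; apply; exact/closerP.
  lia.
have x0w : d x0 w = (2 * s).-2 by have := d_tri x0 w z; rewrite (d_sym w z); lia.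
have wu u : u \in closer x0 v -> d u w = s.-1 /\ d x0 u = s.-1.
  move=> /closerP[vu x0u].
  have x0uE : d x0 u = s.-1 by have := d_tri x0 u v; rewrite (d_sym u v); lia.
  have uz : d u z = s.
    by have := d_tri x0 u z; have := d_tri u v z; rewrite (d_sym u v); lia.
  have : w \in closer u z.
    rewrite (closer_eq (x := x0)) //; try lia.
    by rewrite uz x0z (c_run (i := (2 * s).-1)) //; lia.
  by move=> /closerP[]; have := d_tri x0 u w; lia.
have bE : b (d x0 w) = b s.-1.
  by rewrite x0w b_pred (b_run (i := (2 * s).-2)) //; lia.
have /subsetPn[r rv rx0] : ~~ (farther v w \subset farther x0 w).
  apply/negP => sub.
  have E : farther v w = farther x0 w.
    by apply/eqP; rewrite eqEcard sub !card_farther bE vw /=.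
  have : z \in farther x0 w by apply/fartherP; rewrite d_sym; split=> //; lia.
  by rewrite -E => /fartherP[_]; lia.
have /fartherP[wr vr_gt] := rv.
have vr : d v r = s by have := d_tri v w r; lia.
have sub : closer x0 v \subset closer r v.
  apply/subsetP => u ux0; have [uw x0u] := wu _ ux0; have /closerP[vu _] := ux0.
  apply/closerP; split=> //; rewrite (d_sym r u) (d_sym r v) vr ltnNge.
  apply/negP => ur; move/negP: rx0; apply.
  rewrite (farther_eq (u := u)) ?bE ?uw //; last by lia.
  by apply/fartherP; split=> //; lia.
have E : closer x0 v = closer r v.
  by apply/eqP; rewrite eqEcard sub !card_closer 1?(d_sym r v) ?vr ?x0v //=; lia.
have [|t vt wt] := @closer_ex w v; first by rewrite d_sym; lia.
have : t \in closer x0 v.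
  rewrite E; apply/closerP; split=> //; rewrite (d_sym r v) vr.
  by have := d_tri r w t; rewrite (d_sym r w) wt (d_sym w v); lia.
by move=> /wu[]; rewrite d_sym wt (d_sym w v); lia.
Qed.

End Run.

(** * Bounding the diameter *)

Lemma card_closer_le_degree x y : #|closer x y| <= b 0.
Proof.
rewrite -(d_xx y) -card_farther; apply/subset_leq_card/subsetP => z /closerP[yz _].
by apply/fartherP; rewrite d_xx yz.
Qed.

Lemma c1_eq1 M : (exists x y, d x y = M) -> 0 < M -> c 1 = 1.
Proof.
move=> M_realized M_gt0; have [x [y xy]] := realized M_realized M_gt0.
rewrite -xy -card_closer ?xy // -(cards1 x); congr #|pred_of_set _|.
apply/setP => z; rewrite in_set1; apply/closerP/eqP => [[yz]|->].
  by rewrite xy ltnS leqn0 => /eqP/d_eq0.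
by rewrite d_sym xy d_xx.
Qed.

(** Descent on [s] with [M] fixed, until the run starts at 1; there [c 2 = c 1 = 1]. *)
Lemma no_long_run s M : 1 < c 2 -> 0 < s -> 4 * s <= M -> (exists x y, d x y = M) ->
  ~ (forall i, s <= i <= M -> c i = c s /\ b i = b s).
Proof.
move=> c2 + + Mr; elim: s => // s IHs _ sM run.
have [s0|s_gt0] := posnP s.
  have c1 : c 1 = 1 by apply: (c1_eq1 Mr); lia.
  have [|c21 _] := run 2; first by lia.
  by rewrite s0 c1 in c21; lia.
have crun i : s.+1 <= i <= M -> c i = c s.+1 by case/run.
have brun i : s.+1 <= i <= M -> b i = b s.+1 by case/run.
have cp : c s = c s.+1 by apply: (@c_pred s.+1 M).
have bp : b s = b s.+1 by apply: (@b_pred s.+1 M).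
apply: IHs => //; first lia.
move=> i; case: (ltngtP s i) => // [si iM|<- _ //].
by rewrite cp bp; apply: run; lia.
Qed.

Lemma c_mono_le M i j : (exists x y, d x y = M) -> 0 < i <= j -> j <= M -> c i <= c j.
Proof.
move=> Mr /andP[i0]; elim: j => [|j IHj]; first by lia.
rewrite leq_eqVlt => /orP[/eqP-> //|ij jM]; have := @c_mono M Mr j; have := IHj ij; lia.
Qed.

Lemma b_mono_le M i j : (exists x y, d x y = M) -> i <= j <= M -> b j <= b i.
Proof.
move=> Mr /andP[]; elim: j => [|j IHj]; first by case: i.
rewrite leq_eqVlt => /orP[/eqP-> //|ij jM]; have := @b_mono M Mr j; have := IHj ij; lia.
Qed.

(** The potential [phi] is at most [2 * b 0] up to [M], yet by [no_long_run] it increases whenever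
    its argument is multiplied by 4. *)
Lemma diameter_bound M : 1 < c 2 -> (exists x y, d x y = M) -> M < 4 ^ (2 * b 0 + 2).
Proof.
move=> c2 Mr; rewrite ltnNge; apply/negP => big_M.
pose phi i := c i + (b 0 - b i).
have c_le i : 0 < i <= M -> c i <= b 0.
  move=> /andP[i0 iM]; have [x [y xy]] := realized Mr iM.
  by rewrite -xy -card_closer ?xy // card_closer_le_degree.
have b_le i : i <= M -> b i <= b 0.
  by move=> iM; apply: (b_mono_le Mr).
have step s : 0 < s -> 4 * s <= M -> phi s < phi (4 * s).
  move=> s0 sM.
  have Mr' : exists x y, d x y = 4 * s by apply: (realized Mr).
  have cle : c s <= c (4 * s) by apply: (c_mono_le Mr'); lia.
  have ble : b (4 * s) <= b s by apply: (b_mono_le Mr'); lia.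
  have bs0 : b s <= b 0 by apply: b_le; lia.
  rewrite ltnNge; apply/negP => phi_le.
  have {phi_le} [ceq beq] : c (4 * s) = c s /\ b (4 * s) = b s by rewrite /phi in phi_le; lia.
  (* Monotonicity turns equal values at [s] and [4 * s] into constancy in between. *)
  apply: (no_long_run c2 s0 (leqnn _) Mr') => i /andP[si isM].
  have := @c_mono_le _ s i Mr'; have := @c_mono_le _ i (4 * s) Mr'.
  have := @b_mono_le _ s i Mr'; have := @b_mono_le _ i (4 * s) Mr'.
  rewrite si isM s0 leqnn (leq_trans s0 si) ceq beq /=; lia.
have grow j : 4 ^ j <= M -> j <= phi (4 ^ j).
  elim: j => // j IHj; rewrite expnS => jM.
  apply: leq_ltn_trans (step _ _ jM); last by rewrite expn_gt0.
  by apply: IHj; lia.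
have := grow _ big_M; rewrite leqNgt => /negP; apply.
have := c_le (4 ^ (2 * b 0 + 2)); rewrite expn_gt0 big_M /phi; lia.
Qed.

End ConstantRun.

(** * Cliques in neighbourhoods *)

Lemma leq_card_bigcup (I T : finType) (A : {set I}) (F : I -> {set T}) :
  #|\bigcup_(i in A) F i| <= \sum_(i in A) #|F i|.
Proof.
elim/big_rec2: _ => [|i k B _ IH]; first by rewrite cards0.
by apply: leq_trans (leq_card_setU _ _) _; rewrite leq_add2l.
Qed.

Lemma leq_card_bigcup_const (I T : finType) (A : {set I}) (F : I -> {set T}) k :
  {in A, forall i, #|F i| <= k} -> #|\bigcup_(i in A) F i| <= #|A| * k.
Proof.
move=> Fk; apply: leq_trans (leq_card_bigcup _ _) _.
by rewrite -sum_nat_const; apply: leq_sum.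
Qed.

Lemma card_gt_subsetN (T : finType) (A B : {set T}) :
  #|B| < #|A| -> exists2 x, x \in A & x \notin B.
Proof.
move=> lt; apply/subsetPn; apply: contraTN lt => sub.
by rewrite -leqNgt subset_leq_card.
Qed.

Lemma exists_subset_card (T : finType) (A : {set T}) k : k <= #|A| ->
  exists2 B : {set T}, B \subset A & #|B| = k.
Proof.
move=> /card_geqP[s [us <- sA]]; exists [set x in s].
  by apply/subsetP => x; rewrite inE => /sA.
by rewrite cardsE; apply/card_uniqP.
Qed.

Section Basics.

Variables (T : finType) (e : rel T).
Hypothesis e_sym : forall x y, e x y = e y x.
Hypothesis e_irr : forall x, ~~ e x x.

Definition nb x := [set y | e x y].
Definition cn x y := nb x :&: nb y.

Lemma in_nb x y : (y \in nb x) = e x y. Proof. by rewrite inE. Qed.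

Lemma in_cn x y z : (z \in cn x y) = e x z && e y z.
Proof. by rewrite !inE. Qed.

Lemma adj_neq x y : e x y -> x != y.
Proof. by apply: contraTneq => ->. Qed.

Lemma cliqueS (A B : {set T}) : A \subset B -> clique e B -> clique e A.
Proof.
move=> /subsetP sAB /cliqueP cB; apply/cliqueP => x y /sAB xB /sAB yB.
exact: cB.
Qed.

Lemma clique_setU1 x (K : {set T}) :
  clique e K -> {in K, forall y, e x y} -> clique e (x |: K).
Proof.
move=> /cliqueP cK xK; apply/cliqueP => y z /setU1P[->|yK] /setU1P[->|zK].
- by rewrite eqxx.
- by move=> _; apply: xK.
- by move=> _; rewrite e_sym; apply: xK.
- exact: cK.
Qed.

Lemma indep_setU1 x (K : {set T}) :
  indep e K -> {in K, forall y, ~~ e x y} -> indep e (x |: K).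
Proof.
move=> /indepP cK xK; apply/indepP => y z /setU1P[->|yK] /setU1P[->|zK] //.
- exact: xK.
- by rewrite e_sym; apply: xK.
- exact: cK.
Qed.

End Basics.

(** Splits [U] by the neighbours of one vertex, so that [R p (q+1) + R (p+1) q + 1] serves as
    [R (p+1) (q+1)]. The bound is uniform over all finite types. *)
Lemma ramsey (p q : nat) : exists R, forall (T : finType) (e : rel T),
  (forall x y, e x y = e y x) -> (forall x, ~~ e x x) -> forall U : {set T}, R <= #|U| ->
  (exists K : {set T}, [/\ K \subset U, clique e K & p <= #|K|]) \/
  (exists K : {set T}, [/\ K \subset U, indep e K & q <= #|K|]).
Proof.
elim: p q => [|p IHp] q.
  exists 0 => T e _ _ U _; left; exists set0; rewrite sub0set; split=> //.
  by apply/cliqueP => x y; rewrite in_set0.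
elim: q => [|q [R2 IHq]].
  exists 0 => T e _ _ U _; right; exists set0; rewrite sub0set; split=> //.
  by apply/indepP => x y; rewrite in_set0.
have [R1 {}IHp] := IHp q.+1.
exists (R1 + R2).+1 => T e es ei U Ubig.
have [u uU] : exists u, u \in U by apply/card_gt0P; lia.
have cU := cardsD1 u U; have cUu := cardsID (nb e u) (U :\ u).
have sA : (U :\ u) :&: nb e u \subset U by apply/subsetP => x /setIP[/setD1P[]].
have sB : (U :\ u) :\: nb e u \subset U by apply/subsetP => x /setDP[/setD1P[]].
rewrite uU in cU.
have [A_big|B_big] : R1 <= #|(U :\ u) :&: nb e u| \/ R2 <= #|(U :\ u) :\: nb e u| by lia.
  case: (IHp T e es ei _ A_big) => -[K [KA cK Kp]]; last first.
    by right; exists K; split=> //; apply: subset_trans KA sA.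
  left; exists (u |: K); split.
  - by rewrite subUset sub1set uU (subset_trans KA sA).
  - by apply: clique_setU1 => // y /(subsetP KA) /setIP[_]; rewrite in_nb.
  - rewrite cardsU1; suff -> : u \notin K by [].
    by apply/negP => /(subsetP KA) /setIP[/setD1P[]]; rewrite eqxx.
case: (IHq T e es ei _ B_big) => -[K [KB cK Kq]].
  by left; exists K; split=> //; apply: subset_trans KB sB.
right; exists (u |: K); split.
- by rewrite subUset sub1set uU (subset_trans KB sB).
- by apply: indep_setU1 => // y /(subsetP KB) /setDP[_]; rewrite in_nb.
- rewrite cardsU1; suff -> : u \notin K by [].
  by apply/negP => /(subsetP KB) /setDP[/setD1P[]]; rewrite eqxx.
Qed.

Section Cliques.

Variables (T : finType) (e : rel T).
Hypothesis e_sym : forall x y, e x y = e y x.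
Hypothesis e_irr : forall x, ~~ e x x.

Local Notation nb := (nb e).
Local Notation cn := (cn e).

(** [al] bounds the cocliques in a neighbourhood and [r] is the threshold between few and almost
    all; [c], [lam], [b1] stand for c_2, a_1, b_1. Later [al = m ^ 2] and [r = 2 * m ^ 2]. *)
Variables (al r c lam b1 : nat).
Hypothesis r_gt0 : 0 < r.
Hypothesis claw : forall (x : T) (I : {set T}), indep e I -> {in I, forall y, e x y} -> #|I| <= al.
Hypothesis part : forall (y : T) (Z S : {set T}), [disjoint Z & S] -> clique e (Z :|: S) ->
  y \notin Z -> {in S, forall z, e y z} -> {in Z, forall z, ~~ e y z} ->
  #|Z| < r \/ #|S| < r.
Hypothesis c_gt1 : 1 < c.
Hypothesis card_cn2 : forall x y z, x != y -> ~~ e x y -> z \in cn x y -> #|cn x y| = c.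
Hypothesis cn_clique : forall x y, x != y -> ~~ e x y -> clique e (cn x y).
Hypothesis card_cn1 : forall x y, e x y -> #|cn x y| = lam.
Hypothesis card_nbD : forall x y, e x y -> #|nb x :\: (y |: nb y)| = b1.
Hypothesis b1_gt0 : 0 < b1.

Lemma clique_nb_dichotomy (K : {set T}) z :
  clique e K -> z \notin K -> #|K :\: nb z| < r \/ #|K :&: nb z| < r.
Proof.
move=> cK zK; apply: (@part z).
- by rewrite -setI_eq0; apply/eqP/setP => y; rewrite !inE; case: (e z y); rewrite ?andbF.
- by rewrite setUC setID.
- by rewrite !inE (negPf zK) andbF.
- by move=> y; rewrite !inE => /andP[].
- by move=> y; rewrite !inE => /andP[].
Qed.

(** Neighbours of [z] in [K] are common neighbours of [z] and [y], hence at most [c]; were there [r]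
    of them, fewer than [r] other vertices would remain, too few for [#|K|]. *)
Lemma clique_few_nb (K : {set T}) z y : clique e K -> c + r <= #|K| ->
  z \notin K -> y \in K -> ~~ e z y -> #|K :&: nb z| < r.
Proof.
move=> cK Kbig zK yK zy; rewrite ltnNge; apply/negP => r_le.
have zNy : z != y by apply: contraNneq zK => ->.
have sub : K :&: nb z \subset cn z y.
  apply/subsetP => w; rewrite !inE => /andP[wK zw]; rewrite zw /=.
  apply: (cliqueP _ _ cK) => //; by apply: contraNneq zy => ->.
have /card_gt0P[w /(subsetP sub) wcn] : 0 < #|K :&: nb z| by lia.
have := subset_leq_card sub; rewrite (card_cn2 zNy zy wcn) => le_c.
case: (clique_nb_dichotomy cK zK); last by lia.
have := cardsID (nb z) K; lia.
Qed.

(** Take a largest coclique [I] of [U]. Vertices with two neighbours in [I] are covered by at most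
    [al * al] sets of size [c]; the others fall into at most [al] classes [P i], cliques because a
    non-adjacent pair in [P i] could replace [i] in [I]. *)
Lemma clique_extract x (U : {set T}) L : U \subset nb x ->
  al * L + al * al * c < #|U| -> exists K : {set T}, [/\ K \subset U, clique e K & L < #|K|].
Proof.
move=> /subsetP Ux Ubig.
have ind0 : (set0 \subset U) && indep e set0.
  by rewrite sub0set; apply/indepP => y z; rewrite inE.
case: (@arg_maxnP _ set0 (fun I : {set T} => (I \subset U) && indep e I)
  (fun I : {set T} => #|I|) ind0)
  => I /andP[IU indI] Imax.
have Ixs : {in I, forall y, e x y} by move=> y /(subsetP IU)/Ux; rewrite in_nb.
have Ial : #|I| <= al by apply: claw indI Ixs.
pose P i := [set u in U | [forall j in I, e u j ==> (j == i)]
                          && ((u == i) || e u i)].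
have PU i : P i \subset U by apply/subsetP => u; rewrite inE => /andP[].
have Pclique i : i \in I -> clique e (P i).
  move=> iI; apply/cliqueP => u v; rewrite !inE.
  move=> /and3P[uU /forall_inP uI ui] /and3P[vU /forall_inP vI vi] uv.
  apply/negPn/negP => nuv.
  have nI w : w \in U -> (forall j, j \in I -> e w j ==> (j == i)) ->
      (w == i) || e w i -> {in I :\ i, forall j, ~~ e w j}.
    move=> wU wI wi j /setD1P[ji jI]; apply/negP => wj.
    by have := wI _ jI; rewrite wj (negPf ji).
  have memI w : w \in U -> (forall j, j \in I -> e w j ==> (j == i)) ->
      (w == i) || e w i -> w \notin I :\ i.
    move=> wU wI /orP[/eqP->|wi]; first by rewrite !inE eqxx.
    apply/negP => /setD1P[_ wInI].
    by have := indepP _ _ indI _ _ wInI iI; rewrite wi.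
  have indJ : indep e (u |: (v |: (I :\ i))).
    have indIi : indep e (I :\ i).
      by apply/indepP => a b /setD1P[_ aI] /setD1P[_ bI]; apply: (indepP _ _ indI).
    apply: (indep_setU1 e_sym e_irr); first by apply: (indep_setU1 e_sym e_irr) => //; apply: nI.
    by move=> w /setU1P[-> //|]; apply: nI.
  have := Imax (u |: (v |: (I :\ i))); rewrite indJ andbT subUset sub1set uU.
  rewrite subUset sub1set vU /= (subset_trans (subD1set _ _) IU) => /(_ isT).
  rewrite !cardsU1 (memI v) // in_setU1 (negPf uv) (memI u) // (cardsD1 i I) iI.
  by rewrite -[X in _ <= X]add0n leq_add2r.
case: (boolP [exists i in I, L < #|P i|]) => [/exists_inP[i iI Li]|].
  by exists (P i); split=> //; apply: Pclique.
rewrite negb_exists_in => /forall_inP small.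
have cover : U \subset (\bigcup_(i in I) P i) :|:
                       (\bigcup_(i in I) \bigcup_(j in I :\ i) cn i j).
  apply/subsetP => u uU; apply/setUP.
  have [i iI ui] : exists2 i, i \in I & (u == i) || e u i.
    case: (boolP [exists i in I, (u == i) || e u i]) => [/exists_inP[i iI ui]|].
      by exists i.
    rewrite negb_exists_in => /forall_inP un.
    have indu : indep e (u |: I).
      by apply: (indep_setU1 e_sym e_irr) => // j /un; rewrite negb_or => /andP[].
    have := Imax (u |: I); rewrite indu subUset sub1set uU IU => /(_ isT).
    rewrite cardsU1 /=; suff -> : u \notin I by rewrite -[X in _ <= X]add0n leq_add2r.
    by apply/negP => uI; have := un _ uI; rewrite eqxx.
  case: (boolP [forall j in I, e u j ==> (j == i)]) => [uI|].
    by left; apply/bigcupP; exists i => //; rewrite inE uU uI.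
  rewrite negb_forall_in => /exists_inP[j jI]; rewrite negb_imply => /andP[uj ji].
  right; apply/bigcupP; exists i => //; apply/bigcupP; exists j.
    by rewrite !inE ji.
  rewrite in_cn ![e _ u]e_sym uj andbT.
  case/orP: ui => // /eqP ui; by have := indepP _ _ indI _ _ iI jI; rewrite -ui uj.
have := subset_leq_card cover.
have le1 : #|\bigcup_(i in I) P i| <= #|I| * L.
  by apply: leq_card_bigcup_const => i /small; rewrite -leqNgt.
have le2 : #|\bigcup_(i in I) \bigcup_(j in I :\ i) cn i j| <= #|I| * (#|I| * c).
  apply: leq_card_bigcup_const => i iI; apply: leq_trans (leq_card_bigcup_const (k := c) _) _.
    move=> j /setD1P[ji jI].
    rewrite (@card_cn2 i j x) // ?(eq_sym i) //; first exact: (indepP _ _ indI).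
    by rewrite in_cn ![e _ x]e_sym !Ixs.
  by rewrite leq_mul2r subset_leq_card ?subD1set ?orbT.
have le3 := leq_card_setU (\bigcup_(i in I) P i) (\bigcup_(i in I) \bigcup_(j in I :\ i) cn i j).
move=> le4; move: Ubig; rewrite ltnNge => /negP[].
apply: leq_trans le4 (leq_trans le3 (leq_add (leq_trans le1 _) (leq_trans le2 _))).
  by rewrite leq_mul2r Ial orbT.
by rewrite mulnA !leq_mul.
Qed.

(* All thresholds are linear in [c], with coefficients depending only on [al]
   and [r]; [clique_cap_linear] depends on this. *)
Let L1 := c + r + al * r.
Let W := al * L1 + al * al * c.
Let q := 1 + r + r * r.
Let L := r * W + W + q + c + r + 2.
Definition clique_cap := al * L + al * al * c + al * r + 2 * q + c + r + 4.

(** A vertex adjacent to all of [B] would enlarge it. The parameter [A] admits both a largest clique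
    ([A] empty) and a largest clique through a given edge. *)
Lemma maximal_few_nb (B A : {set T}) : clique e B -> A \subset B -> c + r <= #|B| ->
  (forall K : {set T}, clique e K -> A \subset K -> #|K| <= #|B|) ->
  forall z, z \notin B -> #|B :&: nb z| < r.
Proof.
move=> cB AB Bbig Bmax z zB.
case: (boolP [exists y in B, ~~ e z y]) => [/exists_inP[y yB zy]|].
  exact: (clique_few_nb cB Bbig zB yB zy).
rewrite negb_exists_in => /forall_inP zall.
have := Bmax (z |: B); rewrite cardsU1 zB ltnn => H.
have cU : clique e (z |: B).
  by apply: (clique_setU1 e_sym) => // y /zall; rewrite negbK.
by have := H cU (subset_trans AB (subsetUr _ _)).
Qed.

(** * Excluding cliques much larger than [c] *)

Section LargeClique.

Variables (B1 : {set T}) (x : T).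
Hypothesis B1_clique : clique e B1.
Hypothesis B1_max : forall K : {set T}, clique e K -> #|K| <= #|B1|.
Hypothesis B1_big : clique_cap < #|B1|.
Hypothesis xB1 : x \in B1.

Let Wy y := cn x y :\: B1.

Let few1 z : z \notin B1 -> #|B1 :&: nb z| < r.
Proof.
apply: (maximal_few_nb (A := set0)) => //; rewrite ?sub0set //.
  by move: B1_big; rewrite /clique_cap; clear; lia.
by move=> K cK _; apply: B1_max.
Qed.

Let B1x y : y \in B1 :\ x -> e x y.
Proof.
by move=> /setD1P[yx yB]; apply: (cliqueP _ _ B1_clique) => //; rewrite eq_sym.
Qed.

Let lamE y : y \in B1 :\ x -> lam + 2 = #|B1| + #|Wy y|.
Proof.
move=> yB; rewrite -(card_cn1 (B1x yB)) -(cardsID B1 (cn x y)).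
have -> : cn x y :&: B1 = B1 :\ x :\ y.
  apply/setP => z; rewrite !inE; case: (boolP (z \in B1)) => zB; rewrite ?andbF //.
  rewrite !andbT; apply/idP/idP => [/andP[xz yz]|/andP[zy zx]].
    by rewrite eq_sym (adj_neq e_irr yz) eq_sym (adj_neq e_irr xz).
  move/setD1P: yB => [_ yB].
  by rewrite !(cliqueP _ _ B1_clique) // eq_sym.
have := cardsD1 x B1; have := cardsD1 y (B1 :\ x); rewrite yB xB1 /Wy; clear; lia.
Qed.

(* Otherwise one greedily picks [z] in the sets [Wy y], each time avoiding the
   neighbours of the earlier choices, and obtains a claw at [x]. *)
Let few_bad : #|[set y in B1 :\ x | W < #|Wy y|]| <= al * r.
Proof.
rewrite leqNgt; apply/negP => bad_big.
have greedy i : i <= al.+1 -> exists I : {set T},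
    [/\ indep e I, I \subset nb x :\: B1 & #|I| = i].
  elim: i => [_|i IHi i_le].
    exists set0; rewrite sub0set cards0; split=> //.
    by apply/indepP => a b; rewrite in_set0.
  have [|I [indI Isub cI]] := IHi; first by lia.
  have [y ybad yI] : exists2 y, y \in [set y in B1 :\ x | W < #|Wy y|]
      & y \notin \bigcup_(z in I) (B1 :&: nb z).
    apply: card_gt_subsetN; apply: leq_ltn_trans bad_big.
    apply: leq_trans (leq_card_bigcup_const (k := r) _) _.
      by move=> z /(subsetP Isub) /setDP[_ /few1 /ltnW].
    by rewrite leq_mul2r; lia.
  move: ybad; rewrite inE => /andP[yB Wbig].
  have [xy /setD1P[_ yB1]] := (B1x yB, yB).
  have yIN z : z \in I -> ~~ e z y.
    move=> zI; apply: contra yI => zy; apply/bigcupP; exists z => //.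
    by rewrite inE yB1 in_nb.
  have Wx : Wy y \subset nb x.
    by apply/subsetP => z /setDP[]; rewrite in_cn in_nb => /andP[].
  have [K [KW cK Kbig]] := clique_extract Wx Wbig.
  have cKy : clique e (y |: K).
    apply: (clique_setU1 e_sym) => // z /(subsetP KW) /setDP[]; rewrite in_cn.
    by move=> /andP[].
  (* [y] is adjacent to no vertex of [I], so [clique_few_nb] leaves each of these fewer than [r]
     neighbours in [K]. *)
  have [z zK zI] : exists2 z, z \in K & z \notin \bigcup_(t in I) (K :&: nb t).
    apply: card_gt_subsetN; apply: leq_ltn_trans (Kbig).
    apply: (@leq_trans (#|I| * r)); last first.
      have := leq_mul i_le (leqnn r); rewrite /L1 cI; clear; lia.
    apply: leq_card_bigcup_const => t tI.
    apply: leq_trans (subset_leq_card (setSI (nb t) (subsetUr [set y] K))) _.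
    apply: ltnW; apply: (@clique_few_nb _ _ y) => //; rewrite ?setU11 ?yIN //.
      by apply: leq_trans (subset_leq_card (subsetUr _ _)); move: Kbig; rewrite /L1; clear; lia.
    apply/negP => /setU1P[ty|tK].
      move: tI; rewrite ty => /(subsetP Isub) /setDP[_]; by rewrite yB1.
    have := subsetP KW _ tK; rewrite !inE => /andP[_ /andP[_]].
    by rewrite e_sym (negPf (yIN _ tI)).
  have [/setDP[zcn zB1]] : z \in Wy y := subsetP KW _ zK.
  move: zcn; rewrite in_cn => /andP[xz yz].
  exists (z |: I); split.
  - apply: (indep_setU1 e_sym e_irr) => // t tI; apply: contra zI => zt.
    by apply/bigcupP; exists t => //; rewrite inE zK in_nb e_sym.
  - by rewrite subUset Isub andbT sub1set !inE zB1.
  - rewrite cardsU1 cI; suff -> : z \notin I by [].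
    by apply/negP => /yIN; rewrite e_sym yz.
have [I [indI Isub cI]] := greedy _ (leqnn _).
have := @claw x I indI; rewrite cI ltnn => H.
have xI : {in I, forall z, e x z} by move=> z /(subsetP Isub) /setDP[]; rewrite in_nb.
by have := H xI.
Qed.

Let good_ex (S : {set T}) : #|S| <= q -> exists2 y, y \in B1 :\ x & (#|Wy y| <= W) && (y \notin S).
Proof.
move=> Sq.
have [y yB] : exists2 y, y \in B1 :\ x & y \notin [set y in B1 :\ x | W < #|Wy y|] :|: S.
  apply: card_gt_subsetN; apply: leq_ltn_trans (leq_card_setU _ _) _.
  have := cardsD1 x B1; rewrite xB1 => cB; move: B1_big; rewrite /clique_cap cB.
  by have := few_bad; set X := #|[set _ in _ | _]|; set Y := #|B1 :\ x|; move: Sq; clear; lia.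
rewrite in_setU negb_or inE yB /= -leqNgt => yW.
by exists y.
Qed.

Let lam_ge : #|B1| <= lam + 2.
Proof.
have [|y yB _] := good_ex (S := set0); first by rewrite cards0.
by rewrite (lamE yB) leq_addr.
Qed.

Let lam_le : lam + 2 <= #|B1| + W.
Proof.
have [|y yB /andP[yW _]] := good_ex (S := set0); first by rewrite cards0.
by rewrite (lamE yB) leq_add2l.
Qed.

(** As [b1 > 0], some neighbour [u] of [x] lies outside [B1]. Since [lam >= #|B1| - 2], a large
    clique can be extracted from [cn x u]; a largest clique through [x] and [u] serves as [B2]. *)
Let second_clique : exists B2 : {set T}, [/\ clique e B2, x \in B2, L < #|B2|,
  ~~ (B2 \subset B1) & forall z, z \notin B2 -> #|B2 :&: nb z| < r].
Proof.
have [|y yB _] := good_ex (S := set0); first by rewrite cards0.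
have xy := B1x yB.
have /card_gt0P[u] : 0 < #|nb x :\: (y |: nb y)| by rewrite card_nbD.
move=> /setDP[]; rewrite in_nb => xu; rewrite !inE negb_or => /andP[uy yu].
have uB1 : u \notin B1.
  apply: contra yu => uB; move/setD1P: yB => [_ yB].
  by apply: (cliqueP _ _ B1_clique) => //; rewrite eq_sym.
have cnx : cn x u \subset nb x.
  by apply/subsetP => z; rewrite in_cn in_nb => /andP[].
have [|K [Kcn cK Kbig]] := @clique_extract x (cn x u) L cnx.
  by rewrite card_cn1 //; have := lam_ge; move: B1_big; rewrite /clique_cap; clear; lia.
have clK : clique e (x |: (u |: K)).
  apply: (clique_setU1 e_sym); first apply: (clique_setU1 e_sym) => //.
    by move=> z /(subsetP Kcn); rewrite in_cn => /andP[].
  by move=> z /setU1P[->//|/(subsetP Kcn)]; rewrite in_cn => /andP[].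
have pK : clique e (x |: (u |: K)) && ([set x; u] \subset (x |: (u |: K))).
  by rewrite clK; apply/subsetP => z; rewrite !inE => /orP[]->; rewrite ?orbT.
case: (@arg_maxnP _ _ (fun I : {set T} => clique e I && ([set x; u] \subset I))
  (fun I : {set T} => #|I|) pK) => B2 /andP[cB2 xuB2] B2max.
have B2big : L < #|B2|.
  apply: leq_trans Kbig (leq_trans _ (B2max _ pK)).
  by apply: subset_leq_card; rewrite setUA subsetUr.
exists B2; split=> //.
- by apply: (subsetP xuB2); rewrite !inE eqxx.
- by apply: contra uB1 => /subsetP; apply; apply: (subsetP xuB2); rewrite !inE eqxx orbT.
- apply: (maximal_few_nb (A := [set x; u])) => //; first by move: B2big; rewrite /L; clear; lia.
  by move=> K' cK' sK'; apply: B2max; rewrite cK'.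
Qed.

(* Two disjoint edges between [A] and [B] would induce a quadrangle unless they
   are joined by a further edge. *)
Let cross_few (A B : {set T}) : clique e A -> clique e B -> A :&: B = [set x] ->
  (forall z, z \notin A -> #|A :&: nb z| < r) ->
  (forall z, z \notin B -> #|B :&: nb z| < r) ->
  #|[set y in A :\ x | [exists w in B :\ x, e y w]]| <= q.
Proof.
move=> cA cB AB fA fB.
have AnB y : y \in A :\ x -> y \notin B.
  move=> /setD1P[yx yA]; apply: contra yx => yB.
  by rewrite -in_set1 -AB inE yA.
have BnA y : y \in B :\ x -> y \notin A.
  move=> /setD1P[yx yB]; apply: contra yx => yA.
  by rewrite -in_set1 -AB inE yA.
set X := [set y in _ | _].
have [->|/set0Pn[y0]] := eqVneq X set0; first by rewrite cards0.
rewrite inE => /andP[y0A /exists_inP[w0 w0B y0w0]].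
(* Beside the fixed edge [y0 w0], another edge [y w] with [y != y0] needs [y] adjacent to [w0] or
   [y0] adjacent to [w]; in all this leaves [1 + r + r * r] choices for [y]. *)
have sub : X \subset y0 |: ((A :&: nb w0) :|: \bigcup_(w in (B :\ x) :&: nb y0) (A :&: nb w)).
  apply/subsetP => y; rewrite inE => /andP[yA /exists_inP[w wB yw]].
  have [/setD1P[_ y0A'] /setD1P[_ yA']] := (y0A, yA).
  have [/setD1P[_ w0B'] /setD1P[_ wB']] := (w0B, wB).
  rewrite !in_setU1; case: eqP => //= /eqP yy0.
  rewrite inE; case: (boolP (e w0 y)) => w0y; first by rewrite in_setI yA' in_nb w0y.
  apply/orP; right; apply/bigcupP; exists w; last first.
    by rewrite !inE yA' e_sym yw.
  rewrite in_setI wB in_nb; apply/negPn/negP => y0w.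
  have ww0 : w != w0 by apply: contraNneq w0y => <-; rewrite e_sym.
  have y0Nw : y0 != w by apply: contraNneq (AnB _ y0A) => ->.
  have ycn : y \in cn y0 w.
    by rewrite in_cn [e w y]e_sym yw (cliqueP _ _ cA) // eq_sym.
  have w0cn : w0 \in cn y0 w by rewrite in_cn y0w0 (cliqueP _ _ cB).
  have yw0 : y != w0 by apply: contraNneq (AnB _ yA) => ->.
  by have := cliqueP _ _ (cn_clique y0Nw y0w) _ _ ycn w0cn yw0; rewrite e_sym (negPf w0y).
apply: leq_trans (subset_leq_card sub) _; rewrite cardsU1.
apply: leq_trans (leq_add (leq_b1 _) (leq_card_setU _ _)) _; rewrite /q -addnA leq_add2l.
apply: leq_add; first exact/ltnW/fA/BnA.
apply: leq_trans (leq_card_bigcup_const (k := r) _) _.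
  by move=> w /setIP[/BnA/fA/ltnW].
rewrite leq_mul2r; apply/orP; right; apply: ltnW; apply: leq_ltn_trans (fB _ (AnB _ y0A)).
by apply/subset_leq_card/setSI/subsetDl.
Qed.

Lemma large_clique_false : False.
Proof.
have [B2 [cB2 xB2 B2big B2nB1 few2]] := second_clique.
have [u uB2 uB1] := subsetPn B2nB1.
(* A second common vertex [t] would put [B2 :\: B1] into [Wy t], which has at most [W] elements,
   while [#|B1 :&: B2| < r] and [B2] has more than [L]. *)
have cap : B1 :&: B2 = [set x].
  apply/eqP; rewrite eqEsubset; apply/andP; split; last by rewrite sub1set inE xB1 xB2.
  apply/subsetP => t /setIP[tB1 tB2]; apply/set1P/eqP/negPn/negP => tx.
  have tB1' : t \in B1 :\ x by rewrite in_setD1 tx.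
  have capr : #|B1 :&: B2| < r.
    apply: leq_ltn_trans (few1 uB1); apply/subset_leq_card/subsetP => z /setIP[zB1 zB2].
    rewrite in_setI zB1 in_nb (cliqueP _ _ cB2) //.
    by apply: contraNneq uB1 => ->.
  have sub : B2 :\: B1 \subset Wy t.
    apply/subsetP => z /setDP[zB2 zB1]; rewrite in_setD zB1 in_cn.
    by rewrite !(cliqueP _ _ cB2) //; apply: contraNneq zB1 => <-.
  have := subset_leq_card sub; have := lamE tB1'; have := lam_le.
  have := cardsID B1 B2; rewrite setIC; move: capr B2big; rewrite /L.
  clear; lia.
have cap' : B2 :&: B1 = [set x] by rewrite setIC.
(* [y] has no neighbour in [B2] besides [x], and [Wy y] is small. *)
have [y yB /andP[yW ycross]] := good_ex (cross_few B1_clique cB2 cap few1 few2).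
have crossB2 := cross_few cB2 B1_clique cap' few2 few1.
have yN z : z \in B2 :\ x -> ~~ e y z.
  move=> zB; move: ycross; rewrite inE yB negb_exists_in => /forall_inP; exact.
(* [z] has no neighbour in [B1] besides [x], and none in [Wy y]: the vertices of [Wy y] lie outside
   [B2], so each has fewer than [r] neighbours there. *)
have [z zB] : exists2 z, z \in B2 :\ x & z \notin
    [set y in B2 :\ x | [exists w in B1 :\ x, e y w]] :|: \bigcup_(w in Wy y) (B2 :&: nb w :\: [set w]).
  apply: card_gt_subsetN; apply: leq_ltn_trans (leq_card_setU _ _) _.
  have le : #|\bigcup_(w in Wy y) (B2 :&: nb w :\: [set w])| <= #|Wy y| * r.
    apply: leq_card_bigcup_const => w /setDP[wcn wB1].
    have [wB2|/few2/ltnW] := boolP (w \in B2); last first.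
      by apply: leq_trans; apply/subset_leq_card/subsetDl.
    move: wcn; rewrite in_cn => /andP[xw yw].
    by have := yN w; rewrite in_setD1 wB2 eq_sym (adj_neq e_irr xw) yw => /(_ isT).
  have := cardsD1 x B2; rewrite xB2 => cB; move: B2big; rewrite /L cB.
  have := leq_mul yW (leqnn r); move: le crossB2; clear; lia.
rewrite in_setU negb_or inE zB negb_exists_in => /andP[/forall_inP zN zW].
have [/setD1P[yx yB1] /setD1P[zx zB2]] := (yB, zB).
have yz : y != z.
  by apply: contraNneq zx => yz; rewrite -in_set1 -cap inE -{1}yz yB1.
have xcn : x \in cn y z.
  rewrite in_cn e_sym B1x // e_sym (cliqueP _ _ cB2) // eq_sym //.
have nyz := yN _ zB.
(* As [c >= 2], there is a common neighbour [w] other than [x]; it is adjacent to [x] and outside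
   [B1], hence in [Wy y], against the choice of [z]. *)
have [w wcn wx] : exists2 w, w \in cn y z & w \notin [set x].
  by apply: card_gt_subsetN; rewrite cards1 (card_cn2 yz nyz xcn).
rewrite in_set1 in wx.
have xw : e x w by apply: (cliqueP _ _ (cn_clique yz nyz)) => //; rewrite eq_sym.
move: wcn; rewrite in_cn => /andP[yw zw].
have wB1 : w \notin B1.
  by apply/negP => wB1; have := zN w; rewrite in_setD1 wx wB1 zw => /(_ isT).
case/negP: zW; apply/bigcupP; exists w; first by rewrite in_setD wB1 in_cn xw.
by rewrite in_setD1 !inE zB2 [e w z]e_sym zw (adj_neq e_irr zw).
Qed.

End LargeClique.

Lemma clique_card_le (K : {set T}) : clique e K -> #|K| <= clique_cap.
Proof.
move=> cK; rewrite leqNgt; apply/negP => Kbig.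
case: (@arg_maxnP _ K (clique e) (fun I : {set T} => #|I|) cK) => B cB Bmax.
have Bbig : clique_cap < #|B| := leq_trans Kbig (Bmax _ cK).
have /card_gt0P[x xB] : 0 < #|B| by lia.
exact: (large_clique_false cB Bmax Bbig xB).
Qed.

Lemma card_nb_le x : #|nb x| <= al * clique_cap + al * al * c.
Proof.
rewrite leqNgt; apply/negP => big.
by have [K [_ /clique_card_le]] := clique_extract (subxx _) big; rewrite leqNgt => /negP.
Qed.

(** * Bounding c_2 and b_1 inside a neighbourhood *)

Let far x y := nb x :\: (y |: nb y).

Let in_far x y z : (z \in far x y) = [&& z != y, ~~ e y z & e x z].
Proof. by rewrite !inE negb_or -andbA. Qed.

Let far_cn x y z : e x y -> z \in far x y -> [/\ y != z, ~~ e y z & x \in cn y z].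
Proof.
rewrite in_far in_cn ![e _ x]e_sym eq_sym => xy /and3P[zy yz xz].
by rewrite zy yz xy xz.
Qed.

Let cnD_sub x y z : e x y -> z \in far x y -> cn y z :\ x \subset nb x.
Proof.
move=> xy /(far_cn xy)[yz nyz xcn]; apply/subsetP => w /setD1P[wx wcn].
by rewrite in_nb (cliqueP _ _ (cn_clique yz nyz)) // eq_sym.
Qed.

Let card_cnD x y z : e x y -> z \in far x y -> #|cn y z :\ x| = c.-1.
Proof.
move=> xy /(far_cn xy)[yz nyz xcn]; have := cardsD1 x (cn y z).
by rewrite (card_cn2 yz nyz xcn) xcn => ->.
Qed.

Let cnD_clique x y z : e x y -> z \in far x y -> clique e (cn y z :\ x).
Proof.
move=> xy /(far_cn xy)[yz nyz _]; exact: cliqueS (subD1set _ _) (cn_clique yz nyz).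
Qed.

(** Counts non-adjacent pairs between the clique [M = cn y z :\ x] and the rest of [nb x]. Each [w]
    in [M] is in exactly [b1] pairs, each outside vertex in at most [b1], and at most [2 * b1]
    vertices are outside, each being non-adjacent to [y] or [z]. *)
Lemma c_le_b1 x y : e x y -> c.-1 <= 2 * b1.
Proof.
move=> xy; have /card_gt0P[z zfar] : 0 < #|far x y| by rewrite card_nbD.
have [yz nyz xcn] := far_cn xy zfar.
have xz : e x z by move: zfar; rewrite in_far => /and3P[].
have yfar : y \in far x z by rewrite in_far yz e_sym nyz xy.
set M := cn y z :\ x.
have cM : #|M| = c.-1 := card_cnD xy zfar.
have Mx : {in M, forall w, e x w}.
  by move=> w /(subsetP (cnD_sub xy zfar)); rewrite in_nb.
have outM : #|nb x :\: M| <= 2 * b1.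
  apply: (@leq_trans #|far x y :|: far x z|); last first.
    by apply: leq_trans (leq_card_setU _ _) _; rewrite !card_nbD // mul2n addnn.
  apply/subset_leq_card/subsetP => w /setDP[]; rewrite in_nb => xw.
  rewrite /M in_setD1 in_cn (eq_sym w) (adj_neq e_irr xw) /= in_setU.
  have [->|wy] := eqVneq w y; first by rewrite yfar orbT.
  have [->|wz] := eqVneq w z; first by rewrite zfar.
  by rewrite !in_far wy wz xw !andbT negb_and.
rewrite -(leq_pmul2r b1_gt0); apply: leq_trans (leq_mul outM (leqnn b1)).
have -> : c.-1 * b1 = \sum_(w in M) #|[set v in nb x :\: M | v \in far x w]|.
  rewrite -cM -sum_nat_const; apply: eq_bigr => w wM.
  rewrite -(card_nbD (Mx _ wM)); apply: eq_card => v; rewrite -/(far x w) in_set.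
  case: (boolP (v \in far x w)); rewrite ?andbF // => vfar; rewrite andbT; apply/esym.
  move: vfar; rewrite in_far => /and3P[vw nwv xv]; rewrite in_setD in_nb xv andbT.
  apply: contra nwv => vM; apply: (cliqueP _ _ (cnD_clique xy zfar)) => //.
  by rewrite eq_sym.
rewrite double_count -sum_nat_const; apply: leq_sum => v /setDP[]; rewrite in_nb => xv vM.
rewrite -(card_nbD xv); apply/subset_leq_card/subsetP => w; rewrite in_set => /andP[wM].
rewrite !in_far eq_sym e_sym => /and3P[-> -> _] /=; exact: Mx.
Qed.

(** Removing from each [M z] its intersections with the others leaves disjoint sets of at least
    [k - #|F| * r] elements. *)
Lemma sparse_family_card (F U : {set T}) (M : T -> {set T}) k :
  {in F, forall z, M z \subset U} -> {in F, forall z, #|M z| = k} ->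
  {in F &, forall z z', z != z' -> #|M z :&: M z'| < r} ->
  #|F| * (k - #|F| * r) <= #|U|.
Proof.
move=> MU Mk Mr; pose own z := M z :\: \bigcup_(z' in F :\ z) (M z :&: M z').
apply: (@leq_trans (\sum_(z in F) #|[set v in U | v \in own z]|)).
  rewrite -sum_nat_const; apply: leq_sum => z zF.
  apply: (@leq_trans #|own z|); last first.
    apply/subset_leq_card/subsetP => v vo; rewrite in_set vo andbT.
    by apply: (subsetP (MU _ zF)); move/setDP: vo => [].
  rewrite -(Mk _ zF) cardsD leq_sub2l //.
  apply: leq_trans (subset_leq_card (subsetIr _ _)) _.
  apply: leq_trans (leq_card_bigcup_const (k := r) _) _.
    move=> z' /setD1P[z'z z'F]; apply/ltnW/Mr => //; by rewrite eq_sym.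
  by rewrite leq_mul2r subset_leq_card ?subD1set ?orbT.
rewrite double_count -sum1_card; apply: leq_sum => v _.
rewrite leqNgt; apply/negP => /card_gt1P[z [z' []]].
move=> /setIdP[zF /setDP[vz vz']] /setIdP[z'F /setDP[vMz' _]] zz'.
case/negP: vz'; apply/bigcupP; exists z'; first by rewrite in_setD1 eq_sym zz'.
by rewrite in_setI vz.
Qed.

(* The cliques [M z = cn y z :\ x], [z] in [far x y], all lie in [nb x]; when
   [c] is large many of them share [r] vertices with a common [M z0]. *)
Lemma b1_le K R x y : e x y -> #|nb x| <= K * c ->
  (forall U : {set T}, R <= #|U| ->
    (exists K : {set T}, [/\ K \subset U, clique e K & r <= #|K|]) \/
    (exists K : {set T}, [/\ K \subset U, indep e K & al < #|K|])) ->
  let J := (2 * K).+1 in 2 * (J * r + 1) + r * r + r < c -> b1 <= J * R.+1.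
Proof.
move=> xy nbK ram J c_big; pose M z := cn y z :\ x.
pose fam (F : {set T}) := [&& F \subset far x y, #|F| <= J &
  [forall z in F, forall z' in F, (z != z') ==> (#|M z :&: M z'| < r)]].
have fam0 : fam set0.
  by rewrite /fam sub0set cards0; apply/forall_inP => z; rewrite in_set0.
case: (@arg_maxnP _ set0 fam (fun F : {set T} => #|F|) fam0) => F famF Fmax.
have /and3P[Fsub FJ /forall_inP Fr] := famF.
have Frr : {in F &, forall z z', z != z' -> #|M z :&: M z'| < r}.
  by move=> z z' zF z'F; apply/implyP; have /forall_inP := Fr _ zF; apply.
(* [J] such sets would cover more than [J * c / 2 > K * c] vertices of [nb x]. *)
have F_lt : #|F| < J.
  rewrite ltn_neqAle FJ andbT; apply/eqP => cF.
  have := @sparse_family_card F (nb x) M c.-1.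
  have H1 : {in F, forall z, M z \subset nb x}.
    by move=> z /(subsetP Fsub); apply: cnD_sub.
  have H2 : {in F, forall z, #|M z| = c.-1}.
    by move=> z /(subsetP Fsub); apply: card_cnD.
  move=> /(_ H1 H2 Frr); rewrite cF.
  move: nbK c_big; rewrite /J; set n := #|nb x|; clear; move=> nbK c_big.
  set t := c.-1 - _ => le_n.
  have tc : c < 2 * t by rewrite /t; lia.
  have : (2 * K).+1 * c <= (2 * K).+1 * (2 * t) by rewrite leq_mul2l ltnW.
  nia.
pose cl z0 := [set z in far x y | (z == z0) || (r <= #|M z :&: M z0|)].
(* By maximality of [F], now known to have fewer than [J] members. *)
have cover : far x y \subset \bigcup_(z0 in F) cl z0.
  apply/subsetP => z zfar; apply/bigcupP.
  case: (boolP [exists z0 in F, (z == z0) || (r <= #|M z :&: M z0|)]).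
    by move=> /exists_inP[z0 z0F zz0]; exists z0; rewrite // in_set zfar.
  rewrite negb_exists_in => /forall_inP none.
  have none' z0 : z0 \in F -> z != z0 /\ #|M z :&: M z0| < r.
    by move=> /none; rewrite negb_or -ltnNge => /andP[].
  have zF : z \notin F by apply/negP => /none'[]; rewrite eqxx.
  have : fam (z |: F).
    apply/and3P; split; first by rewrite subUset sub1set zfar.
      by rewrite cardsU1 zF.
    apply/forall_inP => a /setU1P[->|aF]; apply/forall_inP => b /setU1P[->|bF];
      apply/implyP => ab.
    - by rewrite eqxx in ab.
    - by case: (none' _ bF).
    - by rewrite setIC; case: (none' _ aF).
    - exact: Frr.
  by move=> /Fmax /=; rewrite cardsU1 zF /= ltnn.
rewrite leqNgt; apply/negP => b1_big.
have [z0 z0F z0big] : exists2 z0, z0 \in F & R < #|cl z0|.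
  apply/exists_inP; apply: contraLR b1_big; rewrite negb_exists_in -leqNgt => /forall_inP small.
  rewrite -(card_nbD xy); apply: leq_trans (subset_leq_card cover) _.
  apply: leq_trans (leq_card_bigcup_const (k := R) _) _.
    by move=> z /small; rewrite -leqNgt.
  by apply: leq_mul; rewrite ?leqnSn // ltnW.
have z0far := subsetP Fsub _ z0F.
have cl_big : R <= #|cl z0 :\ z0|.
  have := cardsD1 z0 (cl z0); move: z0big; case: (_ \in _); clear; lia.
have clnb : {in cl z0 :\ z0, forall z, [/\ e x z, ~~ e y z, z \in far x y & r <= #|M z :&: M z0|]}.
  move=> z /setD1P[zz0]; rewrite in_set (negPf zz0) /= => /andP[zfar zr].
  by have := zfar; rewrite {1}in_far => /and3P[_ nyz xz].
(* A coclique would form too large a claw at [x], so there is a clique, cut down to exactly [r]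
   vertices. *)
case: (ram _ cl_big) => -[Z [Zsub]]; last first.
  move=> indZ; rewrite ltnNge; case/negP; apply: (claw (x := x)) => // z /(subsetP Zsub).
  by case/clnb.
move=> cZ /exists_subset_card[Z' Z'Z Z'r].
have {}Zsub := subset_trans Z'Z Zsub; have {Z'Z}cZ := cliqueS Z'Z cZ.
(* Each vertex of [Z'] misses fewer than [r] vertices of [M z0], so [S] omits at most [r * r]. Then
   [Z' :|: S] is a clique in which [y] sees all of [S] and nothing of [Z'], against [part]. *)
pose S := [set w in M z0 | [forall z in Z', e z w]].
have cM := cnD_clique xy z0far.
have yM z w : w \in M z -> e y w /\ e z w.
  by move=> /setD1P[_]; rewrite in_cn => /andP[].
have Sbig : c.-1 <= #|S| + r * r.
  rewrite -(card_cnD xy z0far) -/(M z0) -(cardsID S (M z0)).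
  apply: leq_add; first exact/subset_leq_card/subsetIr.
  apply: (@leq_trans #|\bigcup_(z in Z') (M z0 :\: nb z)|).
    apply/subset_leq_card/subsetP => w /setDP[wM]; rewrite in_set wM negb_forall_in.
    by move=> /exists_inP[z zZ zw]; apply/bigcupP; exists z; rewrite // in_setD in_nb zw.
  rewrite -{1}Z'r; apply: leq_card_bigcup_const => z zZ.
  have [xz nyz zfar zr] := clnb _ (subsetP Zsub _ zZ).
  have znM : z \notin M z0 by apply: contra nyz => /yM[].
  case: (clique_nb_dichotomy cM znM) => [/ltnW //|]; rewrite ltnNge => /negP[].
  apply: leq_trans zr (subset_leq_card _); apply/subsetP => w /setIP[/yM[_ zw] wM].
  by rewrite in_setI wM in_nb.
have SM w : w \in S -> w \in M z0 by rewrite in_set => /andP[].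
have ZS z w : z \in Z' -> w \in S -> e z w.
  by move=> zZ; rewrite in_set => /andP[_ /forall_inP]; apply.
have Zy : {in Z', forall z, ~~ e y z} by move=> z /(subsetP Zsub)/clnb[].
have Sy : {in S, forall w, e y w} by move=> w /SM/yM[].
have dZS : [disjoint Z' & S].
  rewrite -setI_eq0; apply/eqP/setP => w; rewrite in_set0; apply/negP => /setIP[/Zy yw /Sy].
  by rewrite (negPf yw).
have cZS : clique e (Z' :|: S).
  apply/cliqueP => a b /setUP[aZ|aS] /setUP[bZ|bS] ab.
  - exact: (cliqueP _ _ cZ).
  - exact: ZS.
  - by rewrite e_sym; apply: ZS.
  - by apply: (cliqueP _ _ cM) => //; apply: SM.
have ynZ : y \notin Z'.
  apply/negP => /(subsetP Zsub)/clnb[_ _]; by rewrite in_far eqxx.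
case: (part dZS cZS ynZ Sy Zy); first by rewrite Z'r ltnn.
by move: Sbig c_big; set a := #|S|; set b := J * r; clear; lia.
Qed.

End Cliques.

(** * The graph metric *)

Section Distance.

Variables (n : nat) (e : rel 'I_n).
Hypothesis e_simple : simple_graph e.
Hypothesis e_conn : connected_graph e.

Let e_sym := e_simple.1.
Let e_irr := e_simple.2.

Lemma ballS k x y : (y \in ball e k.+1 x) = (y \in ball e k x) || [exists z in ball e k x, e z y].
Proof. by rewrite /= in_setU [in X in _ || X]in_set. Qed.

Lemma ball_le i j x : i <= j -> ball e i x \subset ball e j x.
Proof.
elim: j => [|j IHj]; first by case: i.
rewrite leq_eqVlt => /orP[/eqP-> //|/IHj sub].
by apply: subset_trans sub _; apply/subsetP => y yB; rewrite ballS yB.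
Qed.

Lemma ball_add i j x y z : y \in ball e i x -> z \in ball e j y -> z \in ball e (i + j) x.
Proof.
move=> yx; elim: j z => [|j IHj] z; first by rewrite addn0 /= in_set1 => /eqP->.
rewrite ballS addnS ballS => /orP[/IHj->//|/exists_inP[w /IHj wx wz]].
by apply/orP; right; apply/exists_inP; exists w.
Qed.

Lemma ball1 x y : e x y -> y \in ball e 1 x.
Proof. by move=> xy; rewrite ballS; apply/orP; right; apply/exists_inP; exists x; rewrite //= in_set1. Qed.

Lemma ball_sym k x y : y \in ball e k x -> x \in ball e k y.
Proof.
elim: k y => [|k IHk] y; first by rewrite /= !in_set1 eq_sym.
rewrite ballS => /orP[/IHk|/exists_inP[z /IHk zx zy]].
  exact/subsetP/ball_le.
by rewrite -[k.+1]add1n; apply: ball_add zx; apply: ball1; rewrite e_sym.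
Qed.

Definition dist x y := ex_minn (e_conn x y).

Lemma in_ball k x y : (y \in ball e k x) = (dist x y <= k).
Proof.
rewrite /dist; case: ex_minnP => d yd dmin; apply/idP/idP => [/dmin //|dk].
exact: (subsetP (ball_le x dk)).
Qed.

Lemma dist_isE k x y : dist_is e k x y = (dist x y == k).
Proof.
case: k => [|k]; first by rewrite -leqn0 -in_ball /= in_set1.
by rewrite /dist_is !in_ball -ltnNge eqn_leq.
Qed.

Lemma dist_xx x : dist x x = 0.
Proof. by apply/eqP; rewrite -leqn0 -in_ball /= in_set1. Qed.

Lemma dist_eq0 x y : dist x y = 0 -> x = y.
Proof. by move=> /eqP; rewrite -leqn0 -in_ball /= in_set1 => /eqP. Qed.

Lemma dist_sym x y : dist x y = dist y x.
Proof.
have le u v : dist u v <= dist v u by rewrite -in_ball; apply: ball_sym; rewrite in_ball.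
by apply/eqP; rewrite eqn_leq !le.
Qed.

Lemma dist_tri x y z : dist x z <= dist x y + dist y z.
Proof. by rewrite -in_ball; apply: ball_add; rewrite in_ball. Qed.

Lemma dist1 x y : (dist x y == 1) = e x y.
Proof.
apply/idP/idP => [|xy].
  rewrite -dist_isE /dist_is ballS => /andP[/orP[-> //|/exists_inP[z]]].
  by rewrite /= in_set1 => /eqP->.
rewrite eqn_leq -in_ball ball1 //= lt0n; apply/eqP => /dist_eq0 xy_eq.
by rewrite xy_eq (negPf (e_irr y)) in xy.
Qed.

Lemma dist_step x y k : dist x y = k.+1 -> exists2 z, dist x z = k & dist z y = 1.
Proof.
move=> xy; have /eqP := xy; rewrite -dist_isE /dist_is ballS => /andP[/orP[-> //|]].
move=> /exists_inP[z]; rewrite in_ball => xz zy _; have /eqP zy1 : dist z y == 1 by rewrite dist1.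
by exists z => //; have := dist_tri x z y; lia.
Qed.

Lemma card_ball k x D : (forall y, #|[set z | e y z]| <= k) -> #|ball e D x| <= k.+1 ^ D.
Proof.
move=> deg; elim: D => [|D IHD]; first by rewrite cards1.
have sub : ball e D.+1 x \subset ball e D x :|: \bigcup_(z in ball e D x) [set y | e z y].
  apply/subsetP => y; rewrite ballS in_setU => /orP[-> //|/exists_inP[z zB zy]].
  by apply/orP; right; apply/bigcupP; exists z; rewrite ?in_set.
apply: leq_trans (subset_leq_card sub) (leq_trans (leq_card_setU _ _) _).
have : #|\bigcup_(z in ball e D x) [set y | e z y]| <= #|ball e D x| * k.
  exact: leq_card_bigcup_const.
rewrite expnS => le; apply: (@leq_trans (#|ball e D x| * k.+1)).
  by rewrite mulnS leq_add2l.
by rewrite mulnC leq_mul2l IHD orbT.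
Qed.

End Distance.

(** * Conclusion *)

(** As a polynomial in [c], [clique_cap] has degree one and nonnegative coefficients, so for [c > 0]
    each constant term [u] may be replaced by [u * c]. A bound proportional to [c] is what [b1_le]
    requires. *)
Lemma clique_cap_linear al r c : 0 < c ->
  al * clique_cap al r c + al * al * c <= (al * clique_cap al r 1 + al * al) * c.
Proof.
move=> c_gt0; rewrite /clique_cap !muln1.
have lin u : u <= u * c by rewrite leq_pmulr.
have add u v u' v' : u <= u' * c -> v <= v' * c -> u + v <= (u' + v') * c.
  by move=> uu vv; rewrite mulnDl leq_add.
have mul w u u' : u <= u' * c -> w * u <= w * u' * c.
  by move=> uu; rewrite -mulnA leq_mul2l uu orbT.
have lin1 : c <= 1 * c by rewrite mul1n.
repeat (first [exact (leqnn _) | exact lin1 | exact (lin _) | refine (add _ _ _ _ _ _) | refine (mul _ _ _ _)]).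
Qed.

(** [K], [R] and [J] depend on [m] alone. The valency is at most [K * c 2], and either [c 2] is
    below the threshold of [b1_le], or [b 1] is bounded and [c 2 <= 2 * b 1 + 1]; [C] covers both
    cases. *)
Lemma degree_bound (m : nat) : 1 < m -> exists F, forall (n : nat) (e : rel 'I_n) (b c : nat -> nat),
  distance_regular e b c -> terwilliger e -> 1 < c 2 -> smallest_eig_ge e m -> b 0 <= F.
Proof.
move=> m_gt1; pose al := m ^ 2; pose r := 2 * m ^ 2.
pose K := al * clique_cap al r 1 + al * al.
have [R ram] := ramsey r al.+1.
pose J := (2 * K).+1; pose C := 2 * (J * R.+1) + 2 * (J * r + 1) + r * r + r + 2.
exists (K * C) => n e b c [e_simple [e_conn [DRc DRb]]] [[x0 [y0 x0y0]] terw] c2 em.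
have [e_sym e_irr] := e_simple.
pose d := dist e_conn.
have dE := dist_isE e_conn.
have d1 x y : (d x y == 1) = e x y := dist1 e_simple e_conn x y.
have dtri x y z : d x z <= d x y + d y z := dist_tri e_conn x y z.
have dsym x y : d x y = d y x := dist_sym e_simple e_conn x y.
have d2E x y z : x != y -> ~~ e x y -> z \in cn e x y -> d x y = 2.
  move=> xy nxy; rewrite in_cn => /andP[xz yz].
  have := dtri x z y; rewrite (dsym z y); move: xz yz nxy; rewrite -!d1.
  have : d x y <> 0 by move=> /dist_eq0 xyE; rewrite xyE eqxx in xy.
  lia.
have deg x : #|nb e x| = b 0.
  rewrite -(DRb 0 x x); last by rewrite dE dist_xx.
  by apply: eq_card => y; rewrite !inE dE -/d d1 andbb.
have far_card x y : e x y -> #|nb e x :\: (y |: nb e y)| = b 1.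
  move=> xy; rewrite -(DRb 1 y x); last by rewrite dE -/d d1 e_sym.
  apply: eq_card => z; rewrite !inE negb_or dE -/d andbC; case: (boolP (e x z)) => //= xz.
  apply/andP/eqP => [[zy nyz]|yz2].
    by apply: (d2E y z x) => //; rewrite ?in_cn ?(eq_sym y) // e_sym xy e_sym.
  rewrite -d1 yz2; split=> //; apply/eqP => zy.
  by move: yz2; rewrite zy /d dist_xx.
have card_cn2 x y z : x != y -> ~~ e x y -> z \in cn e x y -> #|cn e x y| = c 2.
  move=> xy nxy zcn; rewrite -(DRc 1 x y); last by rewrite dE -/d (d2E _ _ z).
  by apply: eq_card => w; rewrite in_cn !inE dE -/d d1 andbC.
have cn_cl x y : x != y -> ~~ e x y -> clique e (cn e x y).
  move=> xy nxy; apply/cliqueP => u v ucn vcn uv.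
  have xy2 : dist_is e 2 x y by rewrite dE -/d (d2E _ _ u).
  by move: ucn vcn; rewrite !in_cn => /andP[xu yu] /andP[xv yv]; apply: (terw x y).
have card_cn1 x y : e x y -> #|cn e x y| = (b 0).-1 - b 1.
  move=> xy; rewrite -(far_card x y xy) -(deg x).
  have := cardsID (nb e y) (nb e x); have := cardsD1 y (nb e x :\: nb e y).
  have -> : (nb e x :\: nb e y) :\ y = nb e x :\: (y |: nb e y).
    by apply/setP => z; rewrite !inE negb_or andbA.
  rewrite /cn in_setD !in_nb xy (negPf (e_irr y)) /=; lia.
have b1_gt0 : 0 < b 1.
  have /(dist_step e_simple)[w x0w wy0] : dist e_conn x0 y0 = 2 by apply/eqP; rewrite -dE.
  rewrite -(DRb 1 x0 w); last by rewrite dE x0w.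
  by apply/card_gt0P; exists y0; rewrite inE x0y0 andbT -d1 /d wy0.
have m_gt0 : 0 < m by lia.
have al_claw (x : 'I_n) (I : {set 'I_n}) : indep e I -> {in I, forall y, e x y} -> #|I| <= al.
  exact: claw_bound.
have r_part (y : 'I_n) (Z S : {set 'I_n}) : [disjoint Z & S] -> clique e (Z :|: S) ->
  y \notin Z -> {in S, forall z, e y z} -> {in Z, forall z, ~~ e y z} -> #|Z| < r \/ #|S| < r.
  move=> dZS cZS yZ yS ynZ.
  have := partial_clique_bound e_simple em m_gt0 dZS cZS yZ yS ynZ.
  (* If [p] and [q] were both at least [2 * m ^ 2], then [p * q >= m ^ 2 * (p + q)], which exceeds
     [m * (m - 1) * (p + q)]. *)
  rewrite /r; move: #|Z| #|S| m_gt0; clear => p q m_gt0 le.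
  case: (ltnP p (2 * m ^ 2)) => [|p_ge]; first by left.
  case: (ltnP q (2 * m ^ 2)) => [|q_ge]; first by right.
  have := leq_mul p_ge (leqnn q); have := leq_mul (leqnn p) q_ge.
  move: le; rewrite -!mulnn; nia.
have r_gt0 : 0 < r by rewrite /r muln_gt0 expn_gt0 m_gt0.
have bigK : b 0 <= K * c 2.
  rewrite -(deg x0); apply: leq_trans (clique_cap_linear _ _ (ltnW c2)).
  exact: (card_nb_le e_sym e_irr r_gt0 al_claw r_part c2 card_cn2 cn_cl card_cn1 far_card b1_gt0).
apply: leq_trans (bigK) _; rewrite leq_mul2l; apply/orP; right.
have [w x0w] : exists w, e x0 w.
  have /(dist_step e_simple)[w x0w wy0] : dist e_conn x0 y0 = 2 by apply/eqP; rewrite -dE.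
  by exists w; rewrite -d1 /d x0w.
have c_b1 := c_le_b1 e_sym e_irr card_cn2 cn_cl far_card b1_gt0 x0w.
case: (leqP (c 2) (2 * (J * r + 1) + r * r + r)) => [|c_big]; first by rewrite /C; clear; lia.
have b1_le : b 1 <= J * R.+1.
  have nb_le : #|nb e x0| <= K * c 2 by rewrite deg.
  exact: (b1_le e_sym al_claw r_part card_cn2 cn_cl far_card x0w nb_le
    (ram _ e e_sym e_irr) c_big).
by move: b1_le c_b1; rewrite /C; clear; lia.
Qed.

Lemma order_bound (n : nat) (e : rel 'I_n) (b c : nat -> nat) F :
  distance_regular e b c -> terwilliger e -> 1 < c 2 -> b 0 <= F ->
  n <= F.+1 ^ (4 ^ (2 * F + 2)).
Proof.
move=> [e_simple [e_conn [DRc DRb]]] [[x0 _] _] c2 bF.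
have dE := dist_isE e_conn; have dsym := dist_sym e_simple e_conn.
have d1 := dist1 e_simple e_conn; have dtri := dist_tri e_conn.
have dstep := dist_step e_simple (e_conn := e_conn).
(* Neighbours differ by at most one in their distance from [x], so strictly smaller means smaller by
   exactly one, as in [distance_regular]; likewise for larger. *)
have closer_card x y : 0 < dist e_conn x y -> #|closer (dist e_conn) x y| = c (dist e_conn x y).
  case xy: (dist e_conn x y) => [//|i] _; rewrite -(DRc i x y) ?dE ?xy //.
  apply: eq_card => z; rewrite !inE d1 dE xy; case: (boolP (e y z)) => //= yz.
  have := dtri x z y; rewrite xy (dsym z y); move: yz; rewrite -d1 => /eqP->; lia.
have farther_card x y : #|farther (dist e_conn) x y| = b (dist e_conn x y).
  rewrite -(DRb (dist e_conn x y) x y) ?dE //.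
  apply: eq_card => z; rewrite !inE d1 dE; case: (boolP (e y z)) => //= yz.
  have := dtri x y z; move: yz; rewrite -d1 => /eqP->; lia.
have deg y : #|[set z | e y z]| <= F.
  rewrite (leq_trans _ bF) // -(DRb 0 y y) ?dE ?dist_xx //.
  by apply: eq_leq; apply: eq_card => z; rewrite !inE dE d1 andbb.
have diam y : dist e_conn x0 y <= 4 ^ (2 * F + 2).
  apply/ltnW/leq_trans.
    apply: (diameter_bound dsym (dist_xx e_conn) (@dist_eq0 _ _ e_conn) dtri dstep
      closer_card farther_card c2).
    by exists x0, y.
  by rewrite leq_exp2l // leq_add2r leq_mul2l bF orbT.
rewrite -[n in n <= _]card_ord -cardsT.
apply: leq_trans (card_ball x0 (4 ^ (2 * F + 2)) deg).
by apply/subset_leq_card/subsetP => y _; rewrite in_ball diam.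
Qed.

(** The boolean tables on at most [B] points form a finite type; a relation occurs in its
    enumeration as its own table, with the identity as isomorphism. *)
Lemma finitely_many_relations (B : nat) :
  exists (N : nat) (sz : 'I_N -> nat) (G : forall i : 'I_N, rel 'I_(sz i)),
    forall (n : nat) (e : rel 'I_n), n <= B -> exists i : 'I_N, graph_iso e (G i).
Proof.
pose P (i : 'I_B.+1) : finType := {ffun 'I_i * 'I_i -> bool}.
pose T : finType := {i : 'I_B.+1 & P i}.
pose G (t : T) : rel 'I_(tag t) :=
  fun x y => (tagged t : {ffun 'I_(tag t) * 'I_(tag t) -> bool}) (x, y).
exists #|T|, (fun i => nat_of_ord (tag (enum_val i : T))).
exists (fun i => G (enum_val i)) => n e nB.
have nB' : n < B.+1 by [].
pose t : T := Tagged P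
  ([ffun p => e p.1 p.2] : {ffun 'I_(Ordinal nB') * 'I_(Ordinal nB') -> bool}).
exists (enum_rank t); rewrite enum_rankK.
exists id; split; first by exists id.
by move=> x y; rewrite /G /= ffunE.
Qed.

Theorem theorem6p2 (m : nat) (hm : 2 <= m) :
  exists (N : nat) (sz : 'I_N -> nat) (G : forall i : 'I_N, rel 'I_(sz i)),
    forall (n : nat) (e : rel 'I_n) (b c : nat -> nat),
      distance_regular e b c -> terwilliger e -> 2 <= c 2 ->
      smallest_eig_ge e m ->
      exists i : 'I_N, graph_iso e (G i).
Proof.
have [F degF] := degree_bound hm.
have [N [sz [G listG]]] := finitely_many_relations (F.+1 ^ (4 ^ (2 * F + 2))).
exists N, sz, G => n e b c DR ter c2 em; apply: listG.
exact: order_bound DR ter c2 (degF _ _ _ _ DR ter c2 em).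
Qed.
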